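(* Let $\mathcal{A}^1_{\pm}$ be the set of all $(a,b,c,d,e,f)\in\mathbb{R}^6$ such that the Ricci tensor of $\mathcal{M}(a,b,c,d,e,f)$ has rank $1$ and is positive semi-definite ($+$) or negative semi-definite ($-$), and let $\mathcal{O}^1_{\pm}\subset\mathcal{A}^1_{\pm}$ be the subset of those models which do not admit a Type $\mathcal{B}$ structure. Then: (1) $\mathcal{O}^1_{-}$ is empty; every element of $\mathcal{A}^1_{-}$ admits a Type $\mathcal{B}$ structure. (2) The group $\operatorname{GL}_+(2,\mathbb{R})$ of real $2\times 2$ matrices with positive determinant acts without fixed points on $\mathcal{O}^1_{+}$, and this action admits a section $s:\mathbb{R}\to\mathcal{O}^1_{+}$, so that $\mathcal{O}^1_{+}\cong\operatorname{GL}_+(2,\mathbb{R})\times\mathbb{R}$ is a principal fiber bundle over $\mathbb{R}$.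
   Context: For $(a,b,c,d,e,f)\in\mathbb{R}^6$, the Type $\mathcal{A}$ model $\mathcal{M}(a,b,c,d,e,f)$ is $(\mathbb{R}^2,\nabla)$ with torsion free connection with constant Christoffel symbols ($\nabla_{\partial_{x^i}}\partial_{x^j}=\Gamma_{ij}{}^k\partial_{x^k}$) $\Gamma_{11}{}^1=a$, $\Gamma_{11}{}^2=b$, $\Gamma_{12}{}^1=\Gamma_{21}{}^1=c$, $\Gamma_{12}{}^2=\Gamma_{21}{}^2=d$, $\Gamma_{22}{}^1=e$, $\Gamma_{22}{}^2=f$. Its Ricci tensor is $\rho=\begin{pmatrix}(a-d)d+b(f-c) & cd-be\\ cd-be & c(f-c)+(a-d)e\end{pmatrix}$. The group $\operatorname{GL}(2,\mathbb{R})$ acts on $\mathbb{R}^6$ (the space of Type $\mathcal{A}$ models) by linear changes of coordinates $T(x^1,x^2)=(a^1_1x^1+a^1_2x^2,a^2_1x^1+a^2_2x^2)$, transforming the (constant) Christoffel symbols accordingly. A Type $\mathcal{B}$ model is $(\mathbb{R}^+\times\mathbb{R},\nabla)$ where $\nabla$ is torsion free with Christoffel symbols $\Gamma_{ij}{}^k=(x^1)^{-1}A_{ij}{}^k$ for constants $A_{ij}{}^k=A_{ji}{}^k$. An affine surface admits a Type $\mathcal{B}$ structure if it is locally affinely isomorphic to some Type $\mathcal{B}$ model. *)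

(* Defs.v *)
From HB Require Import structures.
From mathcomp Require Import all_boot all_order all_algebra.
From mathcomp Require Import all_classical all_reals all_analysis.
Set Implicit Arguments. Unset Strict Implicit. Unset Printing Implicit Defensive.
Import Order.TTheory GRing.Theory Num.Theory.
Import numFieldNormedType.Exports.
Local Open Scope classical_set_scope.
Local Open Scope ring_scope.

Section AffineSurfaces.
Variable R : realType.

(* A vector of six reals (a,b,c,d,e,f) = (m 0 0, ..., m 0 5).
   Christoffel symbols (0-based indices i j k for 1-based i+1 j+1 k+1):
   Gam m i j k = Gamma_{ij}^k = m 0 (2*(i+j)+k), i.e.
   G_11^1=a, G_11^2=b, G_12^1=G_21^1=c, G_12^2=G_21^2=d, G_22^1=e, G_22^2=f. *)
Definition Gam (m : 'rV[R]_6) (i j k : 'I_2) : R :=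
  m 0 (inord (2 * (i + j) + k)).

(* inverse encoding: build the 6-vector from (symmetric) Christoffel symbols *)
Definition mkA (G : 'I_2 -> 'I_2 -> 'I_2 -> R) : 'rV[R]_6 :=
  \row_(l < 6) G (inord (4 <= l)) (inord (2 <= l)) (inord (odd l)).

(* Action of GL(2,R) by the linear change of coordinates y = A x
   (A i j = a^i_j): the constant Christoffel symbols in the new coordinates,
   Gamma'_{ab}^c = A^c_k Gamma_{ij}^k (A^-1)^i_a (A^-1)^j_b.
   This is a left action: actA (A *m B) m = actA A (actA B m). *)
Definition actA (A : 'M[R]_2) (m : 'rV[R]_6) : 'rV[R]_6 :=
  mkA (fun a b c => \sum_(k < 2) \sum_(i < 2) \sum_(j < 2)
         A c k * Gam m i j k * invmx A i a * invmx A j b).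

Definition ricciA (m : 'rV[R]_6) : 'M[R]_2 :=
  let a := m 0 0 in let b := m 0 1 in let c := m 0 2 in
  let d := m 0 3 in let e := m 0 4 in let f := m 0 5 in
  \matrix_(i < 2, j < 2)
    (if (i == 0) && (j == 0) then (a - d) * d + b * (f - c)
     else if (i == 1) && (j == 1) then c * (f - c) + (a - d) * e
     else c * d - b * e).

Definition psd (M : 'M[R]_2) : Prop := forall v : 'rV[R]_2, 0 <= (v *m M *m v^T) 0 0.
Definition nsd (M : 'M[R]_2) : Prop := forall v : 'rV[R]_2, (v *m M *m v^T) 0 0 <= 0.

Definition ev (i : 'I_2) : 'rV[R]_2 := delta_mx 0 i.

Fixpoint dpart (l : seq 'I_2) (f : 'rV[R]_2 -> R) : 'rV[R]_2 -> R :=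
  match l with
  | [::] => f
  | i :: l' => fun x => derive (dpart l' f) x (ev i)
  end.

Definition smooth_on (U : set 'rV[R]_2) (f : 'rV[R]_2 -> R) : Prop :=
  forall (l : seq 'I_2) (x : 'rV[R]_2), U x ->
    (forall i, derivable (dpart l f) x (ev i)) /\ {for x, continuous (dpart l f)}.

Definition smooth_map_on (U : set 'rV[R]_2) (phi : 'rV[R]_2 -> 'rV[R]_2) : Prop :=
  forall k : 'I_2, smooth_on U (fun x => phi x 0 k).

(* The Type B model with constants B (B_{ij}^k = Gam B i j k) lives on
   R^+ x R = [set y | 0 < y 0 0]; Christoffel symbols Gam B i j k / y^1. *)
Definition half_plane : set 'rV[R]_2 := [set y | 0 < y 0 0].

Definition GamB (B : 'rV[R]_6) (y : 'rV[R]_2) (i j k : 'I_2) : R :=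
  Gam B i j k / y 0 0.

Definition affine_AB (m B : 'rV[R]_6) (U : set 'rV[R]_2)
    (phi : 'rV[R]_2 -> 'rV[R]_2) : Prop :=
  forall x, U x -> forall i j k : 'I_2,
    let phik := fun z => phi z 0 k in
    dpart [:: i; j] phik x
      + \sum_(l < 2) \sum_(n < 2) GamB B (phi x) l n k
           * dpart [:: i] (fun z => phi z 0 l) x
           * dpart [:: j] (fun z => phi z 0 n) x
    = \sum_(p < 2) Gam m i j p * dpart [:: p] phik x.

Definition admitsB (m : 'rV[R]_6) : Prop :=
  exists B : 'rV[R]_6, forall p : 'rV[R]_2,
    exists (U V : set 'rV[R]_2) (phi psi : 'rV[R]_2 -> 'rV[R]_2),
      [/\ open U /\ U p, open V /\ V `<=` half_plane,
          [/\ (forall x, U x -> V (phi x)), (forall y, V y -> U (psi y)),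
              (forall x, U x -> psi (phi x) = x) & (forall y, V y -> phi (psi y) = y)],
          (smooth_map_on U phi /\ smooth_map_on V psi)
        & affine_AB m B U phi].

Definition A1plus : set 'rV[R]_6 :=
  [set m | \rank (ricciA m) = 1%N /\ psd (ricciA m)].
Definition A1minus : set 'rV[R]_6 :=
  [set m | \rank (ricciA m) = 1%N /\ nsd (ricciA m)].
Definition O1plus : set 'rV[R]_6 := [set m | A1plus m /\ ~ admitsB m].
Definition O1minus : set 'rV[R]_6 := [set m | A1minus m /\ ~ admitsB m].

Definition GLplus : set 'M[R]_2 := [set A | 0 < \det A].

End AffineSurfaces.

(* Main.v *)
(* When the Ricci tensor has rank 1 it equals eps w (x) w with eps = +-1, and the
   Christoffel symbols then satisfy w o Gamma = f w (x) w for a scalar f. In a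
   basis Z, Y with w(Z) = 0 and w(Y) = 1 this reads nabla_Z Z = a Z,
   nabla_Z Y = c Z, nabla_Y Y = e Z + f Y, with eps = c (f - c) + a e.

   If f^2 >= 4 eps, the shears Y -> Y + u Z can be used to make a or e vanish;
   then, with alpha, beta the coordinates dual to Z, Y, one of the maps
   (exp beta, exp (a alpha)) and (exp beta, alpha + e/2 beta^2) is an affine
   isomorphism to a Type B model. This always applies when eps = -1.

   Conversely, let eps = 1 and let phi be an affine isomorphism to a Type B
   model. The integrability conditions of the equation satisfied by phi
   (symmetry of third derivatives) show that phi matches the Ricci tensors,
   and differentiating once more that it matches their covariant derivatives
   nabla rho = -2 f w (x) w (x) w. A Type B model carrying such a pair has
   B2 = B4 = B5 = 0, Ricci tensor B3 (1 + B0 - B3) du^2 / u^2 with positive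
   coefficient, and f^2 B3 (1 + B0 - B3) = (1 + B0)^2, whence f^2 >= 4.

   So O^1_+ is the locus f^2 < 4. There a <> 0, and there is exactly one
   positively oriented basis with nabla_Z Z = Z, nabla_Z Y = 0 and
   nabla_Y Y = Z + f Y; it depends continuously on the model, so that the basis
   and f in ]-2, 2[ are the coordinates of the trivial GL_+-bundle. *)

Require Import Defs.
From HB Require Import structures.
From mathcomp Require Import all_boot all_order all_algebra.
From mathcomp Require Import all_classical all_reals all_analysis.
From mathcomp Require Import ring.
Import Order.TTheory GRing.Theory Num.Theory.
Import numFieldNormedType.Exports.
Local Open Scope classical_set_scope.
Local Open Scope ring_scope.

Set Implicit Arguments. Unset Strict Implicit. Unset Printing Implicit Defensive.

(** * Directional derivatives *)

Section Calculus.
Context {R : realType} {V : normedModType R}.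
Implicit Types (f : V -> R) (x u v : V).

(** Both difference quotients are the same function of h, so derivability and the derivative pass to
    the restriction to a line without a limit argument. *)
Lemma growth_line (W : normedModType R) (f : V -> W) x v (s : R) :
  (fun h : R => h^-1 *: (((fun t : R => f (x + t *: v)) \o shift s) (h *: 1)
            - f (x + s *: v)))
  = (fun h : R => h^-1 *: ((f \o shift (x + s *: v)) (h *: v) - f (x + s *: v))).
Proof.
apply/funext => h /=; congr (_ *: (f _ - _)).
by rewrite [h%:A]mulr1 scalerDl addrCA.
Qed.

Lemma derivable_line (W : normedModType R) (f : V -> W) x v (s : R) :
  derivable (fun t : R => f (x + t *: v)) s 1 <-> derivable f (x + s *: v) v.
Proof. by rewrite /derivable growth_line. Qed.

Lemma derive_line (W : normedModType R) (f : V -> W) x v (s : R) :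
  'D_1 (fun t : R => f (x + t *: v)) s = 'D_v f (x + s *: v).
Proof. by rewrite /derive growth_line. Qed.

Lemma is_derive_comp1 f (g : R -> R) x v (df dg : R) :
  is_derive x v f df -> is_derive (f x) 1 g dg ->
  is_derive x v (fun y => g (f y)) (dg * df).
Proof.
move=> fd gd.
have x0 : x + (0 : R) *: v = x by rewrite scale0r addr0.
have fl : is_derive (0 : R) 1 (fun t : R => f (x + t *: v)) df.
  apply: DeriveDef; first by apply/derivable_line; rewrite x0; exact: ex_derive.
  by rewrite derive_line x0; exact: derive_val.
have gl : is_derive (f (x + (0 : R) *: v)) 1 g dg by rewrite x0.
have h := @is_derive1_comp R g (fun t : R => f (x + t *: v)) 0 dg df gl fl.
have hd := (derivable_line (g \o f) x v 0).1 (@ex_derive _ _ _ _ _ _ _ h).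
have hv := derive_line (g \o f) x v 0.
move: (etrans (esym hv) (@derive_val _ _ _ _ _ _ _ h)) hd; rewrite x0 => {}hv hd.
exact: DeriveDef hd hv.
Qed.

Lemma MVT_line f x v (h : R) :
  (forall s : R, `|s| <= `|h| -> derivable f (x + s *: v) v) ->
  exists2 s : R, `|s| <= `|h| & f (x + h *: v) - f x = h * 'D_v f (x + s *: v).
Proof.
move=> fd; pose g (t : R) := f (x + t *: v).
have gd (s : R) : `|s| <= `|h| -> is_derive s 1 g ('D_v f (x + s *: v)).
  move=> sh; apply: DeriveDef; last exact: derive_line.
  by apply/derivable_line; exact: fd.
have gx : g 0 = f x by rewrite /g scale0r addr0.
have gc (a b : R) : (forall s, s \in `[a, b]%R -> `|s| <= `|h|) ->
    {within `[a, b], continuous g}.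
  move=> ab; apply: derivable_within_continuous => s /ab /gd sd.
  exact: ex_derive.
have oc (a b s : R) : s \in `]a, b[%R -> s \in `[a, b]%R.
  exact: subset_itv_oo_cc.
have [h0|h0] := leP 0 h.
  have hs (s : R) : s \in `[0, h]%R -> `|s| <= `|h|.
    by rewrite in_itv/= => /andP[s0 sh]; rewrite !ger0_norm.
  have [s sI e] := MVT_segment h0 (fun s I => gd s (hs s (oc _ _ _ I))) (gc _ _ hs).
  by exists s; [exact: hs|rewrite -gx -/(g h) e subr0 mulrC].
have hs (s : R) : s \in `[h, 0]%R -> `|s| <= `|h|.
  by rewrite in_itv/= => /andP[s0 sh]; rewrite !ler0_norm ?lerN2// ltW.
have [s sI e] := MVT_segment (ltW h0) (fun s I => gd s (hs s (oc _ _ _ I))) (gc _ _ hs).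
exists s; first exact: hs.
by rewrite -gx -/(g h) -opprB e sub0r mulrN opprK mulrC.
Qed.

(** The mean value theorem is applied along u to y |-> f (y + h v) - f y, and then along v to
    ['D_u f]. *)
Lemma second_difference f x u v (h d : R) : 0 < d ->
  `|h| * `|u| + `|h| * `|v| < d ->
  (forall y, `|y - x| < d ->
     [/\ derivable f y u & derivable ('D_u f) y v]) ->
  exists2 y, `|y - x| < d &
    f (x + h *: u + h *: v) - f (x + h *: u) - f (x + h *: v) + f x
    = h ^+ 2 * 'D_v ('D_u f) y.
Proof.
move=> d0 hd fd.
have near (s t : R) : `|s| <= `|h| -> `|t| <= `|h| -> `|x + s *: u + t *: v - x| < d.
  move=> sh th; rewrite -(addrA x) (addrC x) addrK; apply: le_lt_trans hd.
  apply: le_trans (ler_normD _ _) _; rewrite !normrZ.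
  by apply: lerD; apply: ler_wpM2r.
pose g y := f (y + h *: v) - f y.
have gd (s : R) : `|s| <= `|h| -> is_derive (x + s *: u) u g
    ('D_u f (x + s *: u + h *: v) - 'D_u f (x + s *: u)).
  move=> sh.
  have d1 : derivable f (x + s *: u) u.
    by have := near s 0 sh; rewrite normr0 scale0r addr0 => /(_ (normr_ge0 _)) /fd[].
  have d2 : is_derive (x + s *: u) u (fun y => f (y + h *: v))
              ('D_u f (x + s *: u + h *: v)).
    have e : (fun k : R => k^-1 *: (((fun y => f (y + h *: v)) \o shift (x + s *: u))
                 (k *: u) - f (x + s *: u + h *: v)))
        = (fun k : R => k^-1 *: ((f \o shift (x + s *: u + h *: v)) (k *: u)
                 - f (x + s *: u + h *: v))).
      by apply/funext => k /=; rewrite !addrA.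
    apply: DeriveDef; last by rewrite /derive e.
    by rewrite /derivable e; have [] := fd _ (near s h sh (lexx _)).
  have d3 := derivableP d1.
  exact: is_deriveB.
have [s sh e1] := @MVT_line g x u h (fun s sh => @ex_derive _ _ _ _ _ _ _ (gd s sh)).
have [t th e2] := @MVT_line ('D_u f) (x + s *: u) v h
  (fun t th => let: conj _ dd := fd _ (near s t sh th) in dd).
exists (x + s *: u + t *: v); first exact: near.
have := e1; rewrite (@derive_val _ _ _ _ _ _ _ (gd s sh)) e2 /g.
rewrite addrAC => {}e1; rewrite expr2 -mulrA -e1; ring.
Qed.

(** Schwarz's theorem: the second difference is symmetric in u and v, so it equals h^2 times either
    mixed derivative at points close to x, and continuity at x concludes. *)
Lemma derive_sym f x u v :
  (\forall y \near x, [/\ derivable f y u, derivable f y v,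
     derivable ('D_u f) y v & derivable ('D_v f) y u]) ->
  {for x, continuous ('D_v ('D_u f))} -> {for x, continuous ('D_u ('D_v f))} ->
  'D_v ('D_u f) x = 'D_u ('D_v f) x.
Proof.
move=> fd c1 c2; apply/eqP; rewrite -subr_eq0 -normr_le0.
apply/ler_addgt0Pl => e e0; rewrite addr0.
have e20 : 0 < e / 2 by rewrite divr_gt0.
have n1 : \forall y \near x, `|'D_v ('D_u f) x - 'D_v ('D_u f) y| < e / 2.
  by move/cvgrPdist_lt : c1; apply.
have n2 : \forall y \near x, `|'D_u ('D_v f) x - 'D_u ('D_v f) y| < e / 2.
  by move/cvgrPdist_lt : c2; apply.
move: fd n1 n2 => /nbhs_ballP[d1 /= d10 fd] /nbhs_ballP[d2 /= d20 n1].
move=> /nbhs_ballP[d3 /= d30 n2].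
pose d := Num.min d1 (Num.min d2 d3).
have d0 : 0 < d by rewrite !lt_min d10 d20.
have {fd n1 n2}dP y : `|y - x| < d ->
  [/\ [/\ derivable f y u, derivable f y v,
     derivable ('D_u f) y v & derivable ('D_v f) y u],
   `|'D_v ('D_u f) x - 'D_v ('D_u f) y| < e / 2 &
   `|'D_u ('D_v f) x - 'D_u ('D_v f) y| < e / 2].
  rewrite !lt_min => /and3P[y1 y2 y3].
  by split; [apply: fd|apply: n1|apply: n2]; rewrite -ball_normE/= distrC.
(* The summand 1 keeps the denominator positive when u = v = 0 and makes the bound by d strict. *)
pose h := d / (`|u| + `|v| + 1).
have k0 : 0 < `|u| + `|v| + 1 by rewrite ltr_wpDl// addr_ge0.
have h0 : 0 < h by rewrite divr_gt0.
have hd : `|h| * `|u| + `|h| * `|v| < d.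
  rewrite (gtr0_norm h0) -mulrDr /h mulrAC ltr_pdivrMr// ltr_pM2l//.
  by rewrite ltrDl.
have hd' : `|h| * `|v| + `|h| * `|u| < d by rewrite addrC.
have [y1 y1d e1] := @second_difference f x u v h d d0 hd
  (fun y yd => let: And3 (And4 a b c d) _ _ := dP y yd in conj a c).
have [y2 y2d e2] := @second_difference f x v u h d d0 hd'
  (fun y yd => let: And3 (And4 a b c d) _ _ := dP y yd in conj b d).
have [_ /ltW l1 _] := dP _ y1d; have [_ _ /ltW l2] := dP _ y2d.
move: e1 e2 l1 l2 {c1 c2 dP}.
move: ('D_v ('D_u f) x) ('D_v ('D_u f) y1) ('D_u ('D_v f) x) ('D_u ('D_v f) y2).
move=> Ax Ay Bx By e1 e2 l1 l2.
have : h ^+ 2 * Ay = h ^+ 2 * By.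
  by rewrite -e1 -e2 (addrAC x (h *: u)) (addrAC (f _) (- f _)).
move/mulfI => /(_ (lt0r_neq0 (exprn_gt0 _ h0))) ee.
rewrite -(subrKA Ay) [e]splitr (le_trans (ler_normD _ _))//.
by apply: lerD => //; rewrite ee distrC.
Qed.

End Calculus.

(** * Differentiability and the chain rule from continuous partial derivatives *)

Section Plane.
Context {R : realType}.
Implicit Types (f : 'rV[R]_2 -> R) (x h : 'rV[R]_2).

Lemma row2E h : h = h 0 0 *: ev R 0 + h 0 1 *: ev R 1.
Proof.
apply/rowP => i; rewrite !mxE.
by case: i => [[|[|//]] i2]; rewrite ?(mulr0, mulr1, addr0, add0r); congr (h 0 _);
  exact/val_inj.
Qed.

Lemma ler_coord h i : `|h 0 i| <= `|h|.
Proof.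
rewrite [leRHS]/Num.Def.normr/= mx_normrE.
by apply: le_trans (le_bigmax _ _ (0, i)).
Qed.

Let zero_diff : {linear 'rV[R]_2 -> R} := \0.

Lemma littleo_differentiable f x :
  (forall e : R, 0 < e -> exists2 d : R, 0 < d &
    forall h, `|h| < d -> `|f (x + h) - f x| <= e * `|h|) ->
  differentiable f x.
Proof.
move=> fx; apply/diffP => /=.
(* The differential is a chosen linear map with the expansion property, so it is enough to exhibit
   one such map, here zero; [lim (nbhs x)] is x itself. *)
apply: (@getPex _ (fun (df : {linear 'rV[R]_2 -> R}) => continuous df /\
  forall y, f y = f (lim (nbhs x)) + df (y - lim (nbhs x))
                  +o_(y \near x) (y - lim (nbhs x)))).
exists zero_diff; split; first exact: cst_continuous.
suff fE : f = (fun y => f (lim (nbhs x)) + zero_diff (y - lim (nbhs x)))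
    +o_ (nbhs x) (fun y => y - lim (nbhs x)) by move=> y; rewrite {1}fE.
apply/eqaddoP => /= e e0.
have [d d0 dP] := fx e e0.
apply/nbhs_ballP; exists d => //= y; rewrite -ball_normE/= distrC => yd.
rewrite lim_id//= -[(f - _) y]/(f y - (f x + 0)) addr0.
by have := dP _ yd; rewrite [x + _]addrC subrK.
Qed.

(** The increment is split into a horizontal and a vertical segment. On each the mean value theorem
    gives a factor at most e/2, because the partial derivatives vanish at x and are continuous
    there. *)
Lemma C1_flat_differentiable f (D : 'I_2 -> 'rV[R]_2 -> R) x :
  (\forall y \near x, forall i, is_derive y (ev R i) f (D i y)) ->
  (forall i, {for x, continuous (D i)}) ->
  (forall i, D i x = 0) -> differentiable f x.
Proof.
move=> /nbhs_ballP[d1 /= d10 fd] fc f0; apply: littleo_differentiable => e e0.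
have e20 : 0 < e / 2 by rewrite divr_gt0.
have small i : exists2 d : R, 0 < d &
    forall y, `|y - x| < d -> `|D i y| <= e / 2.
  move/cvgrPdist_le : (fc i) => /(_ _ e20)/nbhs_ballP[d /= d0 dP].
  exists d => // y yx; rewrite -normrN -sub0r -(f0 i); apply: dP.
  by rewrite -ball_normE/= distrC.
have [d2 d20 f2] := small 0; have [d3 d30 f3] := small 1.
pose C := `|ev R 0| + `|ev R 1| + 1.
have C0 : 0 < C by rewrite ltr_wpDl// addr_ge0.
exists (Num.min d1 (Num.min d2 d3) / C).
  by rewrite divr_gt0// !lt_min d10 d20.
move=> h; rewrite ltr_pdivlMr// => hC.
have near (s t : R) : `|s| <= `|h 0 0| -> `|t| <= `|h 0 1| ->
    `|x + s *: ev R 0 + t *: ev R 1 - x| < Num.min d1 (Num.min d2 d3).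
  move=> sh th; rewrite -(addrA x) (addrC x) addrK; apply: le_lt_trans hC.
  apply: le_trans (ler_normD _ _) _; rewrite !normrZ /C mulrDr mulr1.
  rewrite -[leLHS]addr0 lerD// mulrDr; apply: lerD; apply: ler_wpM2r => //.
    exact: le_trans sh (ler_coord h _).
  exact: le_trans th (ler_coord h _).
have fd' (s t : R) i : `|s| <= `|h 0 0| -> `|t| <= `|h 0 1| ->
    is_derive (x + s *: ev R 0 + t *: ev R 1) (ev R i) f
      (D i (x + s *: ev R 0 + t *: ev R 1)).
  move=> sh th; apply: fd; rewrite -ball_normE/= distrC.
  by have := near s t sh th; rewrite !lt_min => /andP[].
have fd0 (s : R) : `|s| <= `|h 0 0| ->
    is_derive (x + s *: ev R 0) (ev R 0) f (D 0 (x + s *: ev R 0)).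
  by move=> sh; have := fd' s 0 0 sh; rewrite normr0 scale0r addr0; apply.
have [s sh] := @MVT_line _ _ f x (ev R 0) (h 0 0)
  (fun s sh => @ex_derive _ _ _ _ _ _ _ (fd0 s sh)).
rewrite (@derive_val _ _ _ _ _ _ _ (fd0 s sh)) => e1.
have [t th] := @MVT_line _ _ f (x + h 0 0 *: ev R 0) (ev R 1) (h 0 1)
  (fun t th => @ex_derive _ _ _ _ _ _ _ (fd' _ t 1 (lexx _) th)).
rewrite (@derive_val _ _ _ _ _ _ _ (fd' _ t 1 (lexx _) th)) => e2.
rewrite [in X in f X](row2E h) addrA -(subrKA (f (x + h 0 0 *: ev R 0))) addrC.
rewrite [in leLHS]addrC e1 e2 (le_trans (ler_normD _ _))// [e]splitr mulrDl addrC.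
rewrite !normrM; apply: lerD; rewrite mulrC; apply: ler_pM => //.
- have := near s 0 sh; rewrite normr0 scale0r addr0 => /(_ (normr_ge0 _)).
  by rewrite !lt_min => /and3P[_ ? _]; exact: f2.
- exact: ler_coord.
- have := near _ t (lexx _) th.
  by rewrite !lt_min => /and3P[_ _ ?]; exact: f3.
- exact: ler_coord.
Qed.

Lemma ev_coord i j : ev R i 0 j = (i == j)%:R.
Proof. by rewrite mxE eqxx eq_sym. Qed.

Lemma is_derive_coord x (v : 'rV[R]_2) i :
  is_derive x v (fun y : 'rV[R]_2 => y 0 i) (v 0 i).
Proof.
have idv : derivable (@id 'rV[R]_2) x v by exact: derivable_id.
apply: DeriveDef; first exact: (derivable_mxP id x v).1.
by have := derive_mx idv; rewrite derive_id => {2}->; rewrite mxE.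
Qed.

Lemma C1_differentiable f (D : 'I_2 -> 'rV[R]_2 -> R) x :
  (\forall y \near x, forall i, is_derive y (ev R i) f (D i y)) ->
  (forall i, {for x, continuous (D i)}) -> differentiable f x.
Proof.
move=> fd fc.
pose l (y : 'rV[R]_2) := D 0 x * y 0 0 + D 1 x * y 0 1.
have ld y i : is_derive y (ev R i) l (D i x).
  have d0 := is_derive_coord y (ev R i) 0; have d1 := is_derive_coord y (ev R i) 1.
  apply: is_derive_eq; rewrite !ev_coord.
  case: i {d0 d1} => [[|[|//]] i2] /=; rewrite ![_%:A]mulr1 !scaler0 ?addr0 ?add0r;
    by congr (D _ x); exact: val_inj.
have lD : differentiable l x.
  by apply: differentiableD; apply: differentiableZ; exact: differentiable_coord.
have -> : f = (f - l) + l by rewrite subrK.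
apply: differentiableD => //.
apply: (@C1_flat_differentiable _ (fun i y => D i y - D i x)).
- near=> y => i; have := ld y i.
  have : is_derive y (ev R i) f (D i y) by move: i; near: y.
  move=> ? ?; exact: is_deriveB.
- by move=> i; apply: continuousB; [exact: fc|exact: cst_continuous].
- by move=> i; rewrite subrr.
Unshelve. all: by end_near. Qed.

(** Since phi is only derivable along v, it is restricted to the line through x, where derivability
    is differentiability; the differential of f then composes with it. *)
Lemma is_derive_comp f (phi : 'rV[R]_2 -> 'rV[R]_2) x v
    (D : 'I_2 -> 'rV[R]_2 -> R) :
  (\forall y \near phi x, forall i, is_derive y (ev R i) f (D i y)) ->
  (forall i, {for phi x, continuous (D i)}) ->
  (forall i, derivable (fun y => phi y 0 i) x v) ->
  is_derive x v (f \o phi)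
    (D 0 (phi x) * 'D_v (fun y => phi y 0 0) x
     + D 1 (phi x) * 'D_v (fun y => phi y 0 1) x).
Proof.
move=> fd fc phid.
have fD := C1_differentiable fd fc.
have fx i : 'd f (phi x) (ev R i) = D i (phi x).
  by rewrite -deriveE//; have [_ ->] := nbhs_singleton fd i.
have pd : derivable phi x v.
  by apply/derivable_mxP => i j; rewrite (ord1 i); exact: phid.
pose g (t : R) := phi (x + t *: v).
have x0 : x + (0 : R) *: v = x by rewrite scale0r addr0.
have gd : derivable g 0 1 by apply/derivable_line; rewrite x0.
have g0 : g 0 = phi x by rewrite /g x0.
have gD : differentiable g 0 by exact/derivable1_diffP.
have fgD : differentiable (f \o g) 0.
  by apply: differentiable_comp => //; rewrite g0.
have e : 'D_v phi x = 'D_1 g 0 by rewrite derive_line x0.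
have e' : 'D_v (f \o phi) x = 'D_1 (f \o g) 0.
  by rewrite (derive_line (f \o phi)) x0.
apply: DeriveDef.
  by rewrite -x0; apply/derivable_line/derivable1_diffP.
have d1 : 'd g 0 1 = 'D_v phi x by rewrite e deriveE.
have fDg : differentiable f (g 0) by rewrite g0.
rewrite e' (deriveE _ fgD) (diff_comp gD fDg).
rewrite -[(_ \o _) 1]/('d f (g 0) ('d g 0 1)) d1 g0.
rewrite (row2E ('D_v phi x)) linearD !linearZ !fx.
have dm i : 'D_v (fun y => phi y 0 i) x = ('D_v phi x) 0 i by rewrite (derive_mx pd) mxE.
by rewrite !dm (mulrC (D 0 _)) (mulrC (D 1 _)).
Qed.

End Plane.

(** * Pulling back the curvature of a Type B model *)

Lemma sum2E (R : nmodType) (F : 'I_2 -> R) : \sum_(i < 2) F i = F 0 + F 1.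
Proof. by rewrite !big_ord_recl big_ord0 addr0; congr (_ + F _); exact/val_inj. Qed.

Lemma ord2_ind (P : 'I_2 -> Prop) : P 0 -> P 1 -> forall i, P i.
Proof.
move=> P0 P1 [[|[|//]] i]; [move: P0|move: P1]; congr P; exact/val_inj.
Qed.

Section TypeB.
Variable R : realType.

Lemma GamE (m : 'rV[R]_6) :
  (Gam m 0 0 0 = m 0 0) * (Gam m 0 0 1 = m 0 1) *
  (Gam m 0 1 0 = m 0 2) * (Gam m 0 1 1 = m 0 3) *
  (Gam m 1 0 0 = m 0 2) * (Gam m 1 0 1 = m 0 3) *
  (Gam m 1 1 0 = m 0 4) * (Gam m 1 1 1 = m 0 5).
Proof.
by rewrite /Gam; do !split; congr (m 0 _); apply/val_inj; rewrite /= inordK.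
Qed.

Lemma ricciAE (m : 'rV[R]_6) :
  (ricciA m 0 0 = (m 0 0 - m 0 3) * m 0 3 + m 0 1 * (m 0 5 - m 0 2)) *
  (ricciA m 0 1 = m 0 2 * m 0 3 - m 0 1 * m 0 4) *
  (ricciA m 1 0 = m 0 2 * m 0 3 - m 0 1 * m 0 4) *
  (ricciA m 1 1 = m 0 2 * (m 0 5 - m 0 2) + (m 0 0 - m 0 3) * m 0 4).
Proof. by do !split; rewrite /ricciA mxE. Qed.

Lemma smooth_is_derive (U : set 'rV[R]_2) f (l : seq 'I_2) x i :
  smooth_on U f -> U x ->
  is_derive x (ev R i) (dpart l f) (dpart (i :: l) f x).
Proof. by move=> fU Ux; apply: derivableP; have [] := fU l x Ux. Qed.

Lemma smooth_dpartC (U : set 'rV[R]_2) f (l : seq 'I_2) x i j :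
  open U -> smooth_on U f -> U x ->
  dpart [:: i, j & l] f x = dpart [:: j, i & l] f x.
Proof.
move=> oU fU Ux; apply: (@derive_sym _ _ (dpart l f) x (ev R j) (ev R i)).
- have : nbhs x U by exact: open_nbhs_nbhs.
  apply: filterS => y Uy; split.
  + exact: (fU l y Uy).1.
  + exact: (fU l y Uy).1.
  + exact: (fU (j :: l) y Uy).1.
  + exact: (fU (i :: l) y Uy).1.
- exact: (fU [:: i, j & l] x Ux).2.
- exact: (fU [:: j, i & l] x Ux).2.
Qed.

(* [jac phi k i] is the i-th partial derivative of the k-th component of phi. *)
Definition jac (phi : 'rV[R]_2 -> 'rV[R]_2) (k i : 'I_2) : 'rV[R]_2 -> R :=
  dpart [:: i] (fun y => phi y 0 k).

Lemma jacobian_neq0 (U V : set 'rV[R]_2) phi psi x :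
  open U -> open V -> (forall y, U y -> V (phi y)) ->
  (forall y, U y -> psi (phi y) = y) ->
  smooth_map_on U phi -> smooth_map_on V psi -> U x ->
  jac phi 0 0 x * jac phi 1 1 x - jac phi 0 1 x * jac phi 1 0 x != 0.
Proof.
move=> oU oV UV psiK sphi spsi Ux.
have nU : nbhs x U by exact: open_nbhs_nbhs.
have nV : nbhs (phi x) V by apply: open_nbhs_nbhs; split => //; exact: UV.
pose M k j := jac psi k j (phi x).
have key i k : M k 0 * jac phi 0 i x + M k 1 * jac phi 1 i x = (i == k)%:R.
  have := @is_derive_comp R (fun y => psi y 0 k) phi x (ev R i)
    (jac psi k).
  case.
  - by apply: filterS nV => y Vy j; exact: (smooth_is_derive [::] j (spsi k) Vy).
  - by move=> j; apply: (spsi k [:: j] _ _).2; exact: UV.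
  - by move=> j; exact: (sphi j [::] x Ux).1.
  move=> _ <-; rewrite -(ev_coord i k) -(@derive_val _ _ _ _ _ _ _ (is_derive_coord x (ev R i) k)).
  apply: near_eq_derive; apply: filterS nU => y Uy /=.
  by rewrite psiK.
apply/eqP => D0.
move: key D0; rewrite /M; move: (jac psi) (jac phi) => A C e00 D0.
have : (A 0 0 (phi x) * A 1 1 (phi x) - A 0 1 (phi x) * A 1 0 (phi x)) *
  (C 0 0 x * C 1 1 x - C 0 1 x * C 1 0 x) = 1.
  transitivity ((A 0 0 (phi x) * C 0 0 x + A 0 1 (phi x) * C 1 0 x) *
     (A 1 0 (phi x) * C 0 1 x + A 1 1 (phi x) * C 1 1 x) -
     (A 0 0 (phi x) * C 0 1 x + A 0 1 (phi x) * C 1 1 x) *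
     (A 1 0 (phi x) * C 0 0 x + A 1 1 (phi x) * C 1 0 x)); first by ring.
  by rewrite !e00 /= mulr1 mulr0 subr0.
by rewrite D0 mulr0 => /eqP; rewrite eq_sym oner_eq0.
Qed.

Definition bquad (b0 b1 b2 x0 x1 y0 y1 : R) : R :=
  b0 * (x0 * y0) + b1 * (x0 * y1 + x1 * y0) + b2 * (x1 * y1).

Definition dbquad (b0 b1 b2 x0 x1 y0 y1 dx0 dx1 dy0 dy1 : R) : R :=
  b0 * (dx0 * y0 + x0 * dy0) + b1 * (dx0 * y1 + x0 * dy1 + dx1 * y0 + x1 * dy0)
  + b2 * (dx1 * y1 + x1 * dy1).

Lemma is_derive_bquad (b0 b1 b2 : R) (X0 X1 Y0 Y1 : 'rV[R]_2 -> R) x v dx0 dx1 dy0 dy1 :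
  is_derive x v X0 dx0 -> is_derive x v X1 dx1 ->
  is_derive x v Y0 dy0 -> is_derive x v Y1 dy1 ->
  is_derive x v (fun y => bquad b0 b1 b2 (X0 y) (X1 y) (Y0 y) (Y1 y))
    (dbquad b0 b1 b2 (X0 x) (X1 x) (Y0 x) (Y1 x) dx0 dx1 dy0 dy1).
Proof.
move=> hX0 hX1 hY0 hY1.
have h := is_deriveD (is_deriveD (is_deriveZ b0 (is_deriveM hX0 hY0))
  (is_deriveZ b1 (is_deriveD (is_deriveM hX0 hY1) (is_deriveM hX1 hY0))))
  (is_deriveZ b2 (is_deriveM hX1 hY1)).
apply: (is_derive_eq h); rewrite /dbquad /GRing.scale /=.
move: (X0 x) (X1 x) (Y0 x) (Y1 x) => *; ring.
Qed.

(* The equation of an affine map to a Type B model, solved for its second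
   derivatives; q stands for the reciprocal of the first component, and
   [dhess_rhs] is the derivative of [hess_rhs]. *)
Definition hess_rhs (g0 g1 q f0 f1 b0 b1 b2 x0 x1 y0 y1 : R) : R :=
  g0 * f0 + g1 * f1 - q * bquad b0 b1 b2 x0 x1 y0 y1.
Definition dhess_rhs (g0 g1 q f0 f1 b0 b1 b2 x0 x1 y0 y1 dq df0 df1 dx0 dx1 dy0 dy1 : R) : R :=
  g0 * df0 + g1 * df1 - (dq * bquad b0 b1 b2 x0 x1 y0 y1
    + q * dbquad b0 b1 b2 x0 x1 y0 y1 dx0 dx1 dy0 dy1).

Definition hess (phi : 'rV[R]_2 -> 'rV[R]_2) (k i j : 'I_2) : 'rV[R]_2 -> R :=
  dpart [:: i; j] (fun y => phi y 0 k).

Lemma typeB_connection (m B : 'rV[R]_6) U phi k i j x : affine_AB m B U phi -> U x ->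
  hess phi k i j x =
    hess_rhs (Gam m i j 0) (Gam m i j 1) (phi x 0 0)^-1 (jac phi k 0 x) (jac phi k 1 x)
      (Gam B 0 0 k) (Gam B 0 1 k) (Gam B 1 1 k)
      (jac phi 0 i x) (jac phi 1 i x) (jac phi 0 j x) (jac phi 1 j x).
Proof.
move=> aff Ux; rewrite /hess_rhs /bquad.
have arith (e s q c0 c1 c2 x0 x1 y0 y1 : R) :
    e + (c0 / q * x0 * y0 + c1 / q * x0 * y1 + (c1 / q * x1 * y0 + c2 / q * x1 * y1)) = s ->
    e = s - q^-1 * (c0 * (x0 * y0) + c1 * (x0 * y1 + x1 * y0) + c2 * (x1 * y1)).
  by move=> <-; ring.
have GamC : Gam B 1 0 k = Gam B 0 1 k by rewrite /Gam addnC.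
by apply: arith; have := aff x Ux i j k; rewrite /= !sum2E /GamB GamC.
Qed.

Lemma is_derive_E (g0 g1 b0 b1 b2 : R) (q f0 f1 X0 X1 Y0 Y1 : 'rV[R]_2 -> R) x v
   dq df0 df1 dx0 dx1 dy0 dy1 :
  is_derive x v q dq -> is_derive x v f0 df0 -> is_derive x v f1 df1 ->
  is_derive x v X0 dx0 -> is_derive x v X1 dx1 ->
  is_derive x v Y0 dy0 -> is_derive x v Y1 dy1 ->
  is_derive x v (fun y => hess_rhs g0 g1 (q y) (f0 y) (f1 y) b0 b1 b2 (X0 y) (X1 y) (Y0 y) (Y1 y))
    (dhess_rhs g0 g1 (q x) (f0 x) (f1 x) b0 b1 b2 (X0 x) (X1 x) (Y0 x) (Y1 x)
       dq df0 df1 dx0 dx1 dy0 dy1).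
Proof.
move=> hq h0 h1 hX0 hX1 hY0 hY1.
have hb := is_derive_bquad b0 b1 b2 hX0 hX1 hY0 hY1.
have h := is_deriveB (is_deriveD (is_deriveZ g0 h0) (is_deriveZ g1 h1))
  (is_deriveM hq hb).
apply: (is_derive_eq h); rewrite /dhess_rhs /GRing.scale /=.
move: (dbquad _ _ _ _ _ _ _ _ _ _ _) (bquad _ _ _ _ _ _ _) (q x) => *; ring.
Qed.

(* The Ricci tensor of the Type B model B is [ricB B] / u^2; it need not be
   symmetric. *)
Definition ricB (B : 'rV[R]_6) (x0 x1 y0 y1 : R) : R :=
  let b0 := B 0 0 in let b1 := B 0 1 in let b2 := B 0 2 in
  let b3 := B 0 3 in let b4 := B 0 4 in let b5 := B 0 5 in
  (b3 + ((b0 - b3) * b3 + b1 * (b5 - b2))) * (x0 * y0)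
  + (b5 + (b2 * b3 - b1 * b4)) * (x0 * y1)
  + (- b2 + (b2 * b3 - b1 * b4)) * (x1 * y0)
  + (- b4 + (b2 * (b5 - b2) + (b0 - b3) * b4)) * (x1 * y1).

Lemma is_derive_ricB B (X0 X1 Y0 Y1 : 'rV[R]_2 -> R) x v dx0 dx1 dy0 dy1 :
  is_derive x v X0 dx0 -> is_derive x v X1 dx1 ->
  is_derive x v Y0 dy0 -> is_derive x v Y1 dy1 ->
  is_derive x v (fun y => ricB B (X0 y) (X1 y) (Y0 y) (Y1 y))
    (ricB B dx0 dx1 (Y0 x) (Y1 x) + ricB B (X0 x) (X1 x) dy0 dy1).
Proof.
move=> hX0 hX1 hY0 hY1; 
set s00 := B 0 3 + ((B 0 0 - B 0 3) * B 0 3 + B 0 1 * (B 0 5 - B 0 2)).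
set s01 := B 0 5 + (B 0 2 * B 0 3 - B 0 1 * B 0 4).
set s10 := - B 0 2 + (B 0 2 * B 0 3 - B 0 1 * B 0 4).
set s11 := - B 0 4 + (B 0 2 * (B 0 5 - B 0 2) + (B 0 0 - B 0 3) * B 0 4).
have h := is_deriveD (is_deriveD (is_deriveD (is_deriveZ s00 (is_deriveM hX0 hY0))
  (is_deriveZ s01 (is_deriveM hX0 hY1))) (is_deriveZ s10 (is_deriveM hX1 hY0)))
  (is_deriveZ s11 (is_deriveM hX1 hY1)).
apply: (is_derive_eq h); rewrite /ricB /= -/s00 -/s01 -/s10 -/s11 /GRing.scale /=.
move: (X0 x) (X1 x) (Y0 x) (Y1 x) => *; ring.
Qed.

(** P and Q are the partial derivatives of the two components of the map, and q is the reciprocal of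
    the first component. The four [dhess_rhs] equations equate third derivatives taken in two
    orders. *)
Lemma curvature_arith (m B : 'rV[R]_6) (q P0 P1 Q0 Q1 P00 P01 P11 Q00 Q01 Q11 : R) :
  let a := m 0 0 in let b := m 0 1 in let c := m 0 2 in
  let d := m 0 3 in let e := m 0 4 in let f := m 0 5 in
  let b0 := B 0 0 in let b1 := B 0 1 in let b2 := B 0 2 in
  let b3 := B 0 3 in let b4 := B 0 4 in let b5 := B 0 5 in
  P00 = hess_rhs a b q P0 P1 b0 b2 b4 P0 Q0 P0 Q0 ->
  P01 = hess_rhs c d q P0 P1 b0 b2 b4 P0 Q0 P1 Q1 ->
  P11 = hess_rhs e f q P0 P1 b0 b2 b4 P1 Q1 P1 Q1 ->
  Q00 = hess_rhs a b q Q0 Q1 b1 b3 b5 P0 Q0 P0 Q0 ->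
  Q01 = hess_rhs c d q Q0 Q1 b1 b3 b5 P0 Q0 P1 Q1 ->
  Q11 = hess_rhs e f q Q0 Q1 b1 b3 b5 P1 Q1 P1 Q1 ->
  let dq0 := - (q ^+ 2 * P0) in let dq1 := - (q ^+ 2 * P1) in
  dhess_rhs c d q P0 P1 b0 b2 b4 P1 Q1 P0 Q0 dq0 P00 P01 P01 Q01 P00 Q00
  = dhess_rhs a b q P0 P1 b0 b2 b4 P0 Q0 P0 Q0 dq1 P01 P11 P01 Q01 P01 Q01 ->
  dhess_rhs e f q P0 P1 b0 b2 b4 P1 Q1 P1 Q1 dq0 P00 P01 P01 Q01 P01 Q01
  = dhess_rhs c d q P0 P1 b0 b2 b4 P0 Q0 P1 Q1 dq1 P01 P11 P01 Q01 P11 Q11 ->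
  dhess_rhs c d q Q0 Q1 b1 b3 b5 P1 Q1 P0 Q0 dq0 Q00 Q01 P01 Q01 P00 Q00
  = dhess_rhs a b q Q0 Q1 b1 b3 b5 P0 Q0 P0 Q0 dq1 Q01 Q11 P01 Q01 P01 Q01 ->
  dhess_rhs e f q Q0 Q1 b1 b3 b5 P1 Q1 P1 Q1 dq0 Q00 Q01 P01 Q01 P01 Q01
  = dhess_rhs c d q Q0 Q1 b1 b3 b5 P0 Q0 P1 Q1 dq1 Q01 Q11 P01 Q01 P11 Q11 ->
  P0 * Q1 - P1 * Q0 != 0 ->
  [/\ (a - d) * d + b * (f - c) = q ^+ 2 * ricB B P0 Q0 P0 Q0,
     c * d - b * e = q ^+ 2 * ricB B P0 Q0 P1 Q1,
     c * d - b * e = q ^+ 2 * ricB B P1 Q1 P0 Q0 &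
     c * (f - c) + (a - d) * e = q ^+ 2 * ricB B P1 Q1 P1 Q1].
Proof.
move=> a b c d e f b0 b1 b2 b3 b4 b5; rewrite /ricB /hess_rhs /dhess_rhs /dbquad /bquad /=.
rewrite -/a -/b -/c -/d -/e -/f -/b0 -/b1 -/b2 -/b3 -/b4 -/b5.
move: a b c d e f b0 b1 b2 b3 b4 b5 => a b c d e f b0 b1 b2 b3 b4 b5.
move=> -> -> -> -> -> -> eP0 eP1 eQ0 eQ1 D0.
(* The hypotheses say J eps r = q^2 det(J) eps S J with eps = [[0,1],[-1,0]];
   multiplying by the transpose of J and the inverse of eps isolates det(J) r. *)
have solve (r s u v X Y X' Y' : R) : X = Y -> X' = Y' ->
    (P0 * Q1 - P1 * Q0) * (r - s) = u * (X - Y) - v * (X' - Y') -> r = s.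
  move=> -> ->; rewrite !subrr !mulr0 subrr => /eqP.
  by rewrite mulf_eq0 (negbTE D0) subr_eq0 => /eqP.
split; [apply: (solve _ _ Q0 P0 _ _ _ _ eP0 eQ0)|apply: (solve _ _ Q0 P0 _ _ _ _ eP1 eQ1)
  |apply: (solve _ _ Q1 P1 _ _ _ _ eP0 eQ0)|apply: (solve _ _ Q1 P1 _ _ _ _ eP1 eQ1)];
  ring.
Qed.

(** * Integrability conditions of an affine map to a Type B model *)

Section Isomorphism.
Variables (m B : 'rV[R]_6) (U V : set 'rV[R]_2) (phi psi : 'rV[R]_2 -> 'rV[R]_2).
Hypotheses (oU : open U) (oV : open V) (Vpos : V `<=` @half_plane R).
Hypotheses (UV : forall y, U y -> V (phi y)) (psiK : forall y, U y -> psi (phi y) = y).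
Hypotheses (sphi : smooth_map_on U phi) (spsi : smooth_map_on V psi).
Hypothesis aff : affine_AB m B U phi.

Let jacD k i x l : U x -> is_derive x (ev R l) (jac phi k i) (hess phi k l i x).
Proof. by move=> Ux; exact: (smooth_is_derive [:: i] l (sphi k) Ux). Qed.

Let hessC k i j x : U x -> hess phi k i j x = hess phi k j i x.
Proof. by move=> Ux; exact: (smooth_dpartC [::] i j oU (sphi k) Ux). Qed.

Let posP x : U x -> phi x 0 0 != 0.
Proof. by move=> Ux; apply: lt0r_neq0; exact/Vpos/UV. Qed.

Let q x := (phi x 0 0)^-1.

Let qD x l : U x -> is_derive x (ev R l) q (- (q x ^+ 2 * jac phi 0 l x)).
Proof.
move=> Ux; have := smooth_is_derive [::] l (sphi 0) Ux => /= h.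
apply: DeriveDef; first exact: (derivableV (posP Ux) ex_derive).
rewrite /q (deriveV (posP Ux) ex_derive) derive_val /q exprVn.
by rewrite -mulNr.
Qed.

Lemma typeB_third k l i j x : U x ->
  dpart [:: l; i; j] (fun y => phi y 0 k) x =
  dhess_rhs (Gam m i j 0) (Gam m i j 1) (q x) (jac phi k 0 x) (jac phi k 1 x)
     (Gam B 0 0 k) (Gam B 0 1 k) (Gam B 1 1 k)
     (jac phi 0 i x) (jac phi 1 i x) (jac phi 0 j x) (jac phi 1 j x)
     (- (q x ^+ 2 * jac phi 0 l x)) (hess phi k l 0 x) (hess phi k l 1 x)
     (hess phi 0 l i x) (hess phi 1 l i x) (hess phi 0 l j x) (hess phi 1 l j x).
Proof.
move=> Ux.
have := is_derive_E (Gam m i j 0) (Gam m i j 1)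
  (Gam B 0 0 k) (Gam B 0 1 k) (Gam B 1 1 k) (qD l Ux)
  (jacD k 0 l Ux) (jacD k 1 l Ux) (jacD 0 i l Ux) (jacD 1 i l Ux)
  (jacD 0 j l Ux) (jacD 1 j l Ux).
move=> [_ <-]; apply: near_eq_derive.
have : nbhs x U by exact: open_nbhs_nbhs.
by apply: filterS => y Uy; exact: (typeB_connection k i j aff Uy).
Qed.

Lemma ricci_pullback i j x : U x ->
  ricciA m i j = q x ^+ 2 * ricB B (jac phi 0 i x) (jac phi 1 i x) (jac phi 0 j x) (jac phi 1 j x).
Proof.
move=> Ux.
have D0 := jacobian_neq0 oU oV UV psiK sphi spsi Ux.
have third k l : dpart [:: 0; 1; l] (fun y => phi y 0 k) x
                 = dpart [:: 1; 0; l] (fun y => phi y 0 k) x.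
  exact: (smooth_dpartC [:: l] 0 1 oU (sphi k) Ux).
have e00 := third 0 0; have e01 := third 0 1.
have e10 := third 1 0; have e11 := third 1 1.
move: e00 e01 e10 e11.
rewrite !(typeB_third _ _ _ _ Ux) !(hessC _ 1 0 Ux) !GamE => e00 e01 e10 e11.
have conn k u v := typeB_connection k u v aff Ux.
have c000 := conn 0 0 0; have c001 := conn 0 0 1; have c011 := conn 0 1 1.
have c100 := conn 1 0 0; have c101 := conn 1 0 1; have c111 := conn 1 1 1.
move: c000 c001 c011 c100 c101 c111; rewrite -/(q x) !GamE.
move=> c000 c001 c011 c100 c101 c111.
have [h00 h01 h10 h11] := curvature_arith c000 c001 c011 c100 c101 c111 e00 e01 e10 e11 D0.
elim/ord2_ind: i; elim/ord2_ind: j; rewrite ricciAE.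
- exact: h00.
- exact: h01.
- exact: h10.
- exact: h11.
Qed.

(** A Type A model has a constant Ricci matrix, so the right side of [ricci_pullback] has zero
    derivative; the cube of q comes from differentiating its square. *)
Lemma ricci_pullback_derive k i j x : U x ->
  q x ^+ 3 * (2 * jac phi 0 k x *
    ricB B (jac phi 0 i x) (jac phi 1 i x) (jac phi 0 j x) (jac phi 1 j x)) =
  q x ^+ 2 * (
    ricB B (hess phi 0 k i x) (hess phi 1 k i x) (jac phi 0 j x) (jac phi 1 j x)
  + ricB B (jac phi 0 i x) (jac phi 1 i x) (hess phi 0 k j x) (hess phi 1 k j x)).
Proof.
move=> Ux.
have h := is_deriveM (is_deriveM (qD k Ux) (qD k Ux))
  (is_derive_ricB B (jacD 0 i k Ux) (jacD 1 i k Ux) (jacD 0 j k Ux) (jacD 1 j k Ux)).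
have c : is_derive x (ev R k) (q * q * (fun y => ricB B (jac phi 0 i y) (jac phi 1 i y)
    (jac phi 0 j y) (jac phi 1 j y))) 0.
  have hc := @is_derive_cst R 'rV[R]_2 R (ricciA m i j) x (ev R k).
  apply: near_eq_is_derive hc.
  have : nbhs x U by exact: open_nbhs_nbhs.
  by apply: filterS => y Uy; rewrite (ricci_pullback _ _ Uy) expr2.
have := @derive_val _ _ _ _ _ _ _ h; rewrite (@derive_val _ _ _ _ _ _ _ c).
rewrite /GRing.scale /= -[(q * q) x]/(q x * q x).
have arith (s1 s2 s3 qx jx : R) : 0 = qx * qx * (s2 + s3) +
    s1 * (qx * - (qx ^+ 2 * jx) + qx * - (qx ^+ 2 * jx)) ->
    qx ^+ 3 * (2 * jx * s1) = qx ^+ 2 * (s2 + s3).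
  by move=> e; apply/esym/eqP; rewrite -subr_eq0; apply/eqP; rewrite [RHS]e; ring.
exact: arith.
Qed.

End Isomorphism.

End TypeB.

(** * Adapted frames *)

Section Frames.
Variable R : realType.
Implicit Types (m : 'rV[R]_6) (A : 'M[R]_2).

(** The component k of nabla_x y for constant vector fields x and y, where no derivative of y
    enters. *)
Definition conn m (k : 'I_2) (x0 x1 y0 y1 : R) : R :=
  bquad (Gam m 0 0 k) (Gam m 0 1 k) (Gam m 1 1 k) x0 x1 y0 y1.

(* The columns Z, Y of A satisfy
   nabla_Z Z = a Z, nabla_Z Y = c Z and nabla_Y Y = e Z + f Y. *)
Definition adapted m A (a c e f : R) : Prop :=
  A 0 0 * A 1 1 - A 0 1 * A 1 0 != 0 /\
  forall k, [/\ conn m k (A 0 0) (A 1 0) (A 0 0) (A 1 0) = a * A k 0,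
      conn m k (A 0 0) (A 1 0) (A 0 1) (A 1 1) = c * A k 0 &
      conn m k (A 0 1) (A 1 1) (A 0 1) (A 1 1) = e * A k 0 + f * A k 1].

(** A symmetric form is determined by its values on a basis; the formulas are the congruence by the
    inverse of the matrix with columns z and y. *)
Lemma bquad_solve (b0 b1 b2 z0 z1 y0 y1 u v w : R) : z0 * y1 - y0 * z1 != 0 ->
  bquad b0 b1 b2 z0 z1 z0 z1 = u -> bquad b0 b1 b2 z0 z1 y0 y1 = v ->
  bquad b0 b1 b2 y0 y1 y0 y1 = w ->
  [/\ b0 = (y1 ^+ 2 * u - 2 * y1 * z1 * v + z1 ^+ 2 * w) / (z0 * y1 - y0 * z1) ^+ 2,
      b1 = (- y0 * y1 * u + (y1 * z0 + y0 * z1) * v - z0 * z1 * w)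
           / (z0 * y1 - y0 * z1) ^+ 2 &
      b2 = (y0 ^+ 2 * u - 2 * y0 * z0 * v + z0 ^+ 2 * w) / (z0 * y1 - y0 * z1) ^+ 2].
Proof. by move=> D0 <- <- <-; rewrite /bquad; split; field. Qed.

Lemma adapted_conn m A a c e f : adapted m A a c e f ->
  let z0 := A 0 0 in let z1 := A 1 0 in let y0 := A 0 1 in let y1 := A 1 1 in
  forall k, [/\
  Gam m 0 0 k = (y1 ^+ 2 * (a * A k 0) - 2 * y1 * z1 * (c * A k 0)
     + z1 ^+ 2 * (e * A k 0 + f * A k 1)) / (z0 * y1 - y0 * z1) ^+ 2,
  Gam m 0 1 k = (- y0 * y1 * (a * A k 0) + (y1 * z0 + y0 * z1) * (c * A k 0)
     - z0 * z1 * (e * A k 0 + f * A k 1)) / (z0 * y1 - y0 * z1) ^+ 2 &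
  Gam m 1 1 k = (y0 ^+ 2 * (a * A k 0) - 2 * y0 * z0 * (c * A k 0)
     + z0 ^+ 2 * (e * A k 0 + f * A k 1)) / (z0 * y1 - y0 * z1) ^+ 2].
Proof. by case=> D0 h z0 z1 y0 y1 k; have [] := h k; exact: bquad_solve. Qed.

(** The second row of the inverse of A, that is the covector w with w(Z) = 0 and w(Y) = 1. *)
Definition coframe A (i : 'I_2) : R :=
  (if i == 0 then - A 1 0 else A 0 0) / (A 0 0 * A 1 1 - A 0 1 * A 1 0).

(** In the frame Z, Y the symbols b and d vanish, so the Ricci tensor has only its Y, Y entry. *)
Lemma adapted_ricci m A a c e f i j : adapted m A a c e f ->
  ricciA m i j = (c * (f - c) + a * e) * coframe A i * coframe A j.
Proof.
move=> h; have [D0 _] := h.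
have [] := adapted_conn h 0; have [] := adapted_conn h 1; rewrite !GamE.
move=> m1 m3 m5 m0 m2 m4.
by elim/ord2_ind: i; elim/ord2_ind: j; rewrite ricciAE ?m0 ?m1 ?m2 ?m3 ?m4 ?m5 /coframe /=;
  move: (A 0 0) (A 0 1) (A 1 0) (A 1 1) D0 {h m0 m1 m2 m3 m4 m5} => z0 y0 z1 y1 D0; field.
Qed.

(** The covector w reads Y components, and among nabla_Z Z, nabla_Z Y, nabla_Y Y only the last has
    one. *)
Lemma adapted_coframe m A a c e f i j : adapted m A a c e f ->
  Gam m i j 0 * coframe A 0 + Gam m i j 1 * coframe A 1 = f * coframe A i * coframe A j.
Proof.
move=> h; have [D0 _] := h.
have [] := adapted_conn h 0; have [] := adapted_conn h 1; rewrite !GamE.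
move=> m1 m3 m5 m0 m2 m4.
by elim/ord2_ind: i; elim/ord2_ind: j; rewrite !GamE ?m0 ?m1 ?m2 ?m3 ?m4 ?m5 /coframe /=;
  move: (A 0 0) (A 0 1) (A 1 0) (A 1 1) D0 {h m0 m1 m2 m3 m4 m5} => z0 y0 z1 y1 D0; field.
Qed.

Lemma coframe_dual A : A 0 0 * A 1 1 - A 0 1 * A 1 0 != 0 ->
  (coframe A 0 * A 0 0 + coframe A 1 * A 1 0 = 0) *
  (coframe A 0 * A 0 1 + coframe A 1 * A 1 1 = 1).
Proof. by rewrite /coframe /= => D0; split; field. Qed.

(* The covariant derivative of the Ricci tensor of B is - [nablaB B] / u^3. *)
Definition nablaB (B : 'rV[R]_6) (x0 x1 y0 y1 w0 w1 : R) : R :=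
  2 * x0 * ricB B y0 y1 w0 w1
  + ricB B (bquad (B 0 0) (B 0 2) (B 0 4) x0 x1 y0 y1)
           (bquad (B 0 1) (B 0 3) (B 0 5) x0 x1 y0 y1) w0 w1
  + ricB B y0 y1 (bquad (B 0 0) (B 0 2) (B 0 4) x0 x1 w0 w1)
                 (bquad (B 0 1) (B 0 3) (B 0 5) x0 x1 w0 w1).

(** The vectors z and y are the images of Z and Y. First z is shown to be vertical, then B4, B2 and
    B5 vanish in turn, and the two normalisations give relations between f, B0 and B3 alone. *)
Lemma typeB_bound (B : 'rV[R]_6) (q f z0 z1 y0 y1 : R) :
  q != 0 -> z0 * y1 - y0 * z1 != 0 ->
  ricB B z0 z1 z0 z1 = 0 -> ricB B z0 z1 y0 y1 = 0 -> ricB B y0 y1 z0 z1 = 0 ->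
  q ^+ 2 * ricB B y0 y1 y0 y1 = 1 ->
  nablaB B z0 z1 z0 z1 y0 y1 = 0 ->
  nablaB B z0 z1 y0 y1 y0 y1 = 0 -> nablaB B y0 y1 z0 z1 y0 y1 = 0 ->
  nablaB B y0 y1 y0 y1 z0 z1 = 0 ->
  q ^+ 3 * nablaB B y0 y1 y0 y1 y0 y1 = 2 * f ->
  4 <= f ^+ 2.
Proof.
move=> q0 D0 zz zy yz yy tzzy tzyy tyzy tyyz tyyy.
have s0 : ricB B y0 y1 y0 y1 != 0.
  by apply: contra_eqN yy => /eqP ->; rewrite mulr0 eq_sym oner_eq0.
(* As [ricB] need not be symmetric, z is placed in its left and right kernels separately, by
   expanding w in the basis z, y. *)
have left0 w0 w1 : ricB B z0 z1 w0 w1 = 0.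
  apply: (mulfI D0); rewrite mulr0.
  transitivity ((w0 * y1 - w1 * y0) * ricB B z0 z1 z0 z1
    + (z0 * w1 - z1 * w0) * ricB B z0 z1 y0 y1).
    by rewrite /ricB /=; ring.
  by rewrite zz zy !mulr0 addr0.
have right0 w0 w1 : ricB B w0 w1 z0 z1 = 0.
  apply: (mulfI D0); rewrite mulr0.
  transitivity ((w0 * y1 - w1 * y0) * ricB B z0 z1 z0 z1
    + (z0 * w1 - z1 * w0) * ricB B y0 y1 z0 z1).
    by rewrite /ricB /=; ring.
  by rewrite zz yz !mulr0 addr0.
(* The components (y, z, y) and (y, y, z) say that the connection term of y and z pairs to zero with
   y on either side; the component (z, y, y) is then 2 z0 times the Ricci value at y, y. *)
have z00 : z0 = 0.
  have : 2 * z0 * ricB B y0 y1 y0 y1 = 0.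
    move: tzyy tyzy tyyz; rewrite /nablaB !left0 !right0 !mulr0 !addr0 !add0r.
    have bC b0 b1 b2 : bquad b0 b1 b2 z0 z1 y0 y1 = bquad b0 b1 b2 y0 y1 z0 z1.
      by rewrite /bquad; ring.
    by move=> e ey ey'; move: e; rewrite !bC ey ey' !addr0.
  by move/eqP; rewrite mulf_eq0 (negbTE s0) orbF mulf_eq0 pnatr_eq0 /= => /eqP.
subst z0; move: D0; rewrite mul0r sub0r oppr_eq0 mulf_eq0 => /norP[y00 z10].
move: zz zy yz yy s0 tzzy tyzy tyyy; rewrite /nablaB /ricB /=.
set s00 := B 0 3 + _; set s01 := B 0 5 + _; set s10 := - B 0 2 + _; set s11 := - B 0 4 + _.
move=> zz zy yz yy s0 tzzy tyzy tyyy.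
have e11 : s11 = 0.
  apply/eqP; move/eqP: zz; rewrite !mul0r !mulr0 !add0r mulf_eq0 => /orP[//|].
  by rewrite mulf_eq0 orbb (negbTE z10).
have e10 : s10 = 0.
  apply/eqP; move/eqP: zy; rewrite e11 !mul0r !mulr0 !add0r !addr0 mulf_eq0 => /orP[//|].
  by rewrite mulf_eq0 (negbTE z10) (negbTE y00).
have e01 : s01 = 0.
  apply/eqP; move/eqP: yz; rewrite e11 e10 !mul0r !mulr0 !add0r !addr0 mulf_eq0 => /orP[//|].
  by rewrite mulf_eq0 (negbTE z10) (negbTE y00).
move: yy s0 tzzy tyzy tyyy; rewrite e11 e10 e01 !mul0r !addr0 => yy s0 tzzy tyzy tyyy.
have s000 : s00 != 0 by move: s0; rewrite mulf_eq0 => /norP[].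
have simp0 := (mulr0, mul0r, addr0, add0r, orbF, orFb).
have b4 : B 0 4 = 0.
  move/eqP: tzzy; rewrite /bquad !simp0 !mulf_eq0.
  by rewrite (negbTE s000) (negbTE y00) (negbTE z10) !simp0 => /eqP.
have b2 : B 0 2 = 0.
  move/eqP: tyzy; rewrite /bquad b4 !simp0 !mulf_eq0.
  by rewrite (negbTE s000) (negbTE y00) (negbTE z10) !simp0 => /eqP.
have b5 : B 0 5 = 0 by rewrite -e01 /s01 b2 b4 !(mul0r, mulr0) subr0 addr0.
have s00E : s00 = B 0 3 * (1 + B 0 0 - B 0 3) by rewrite /s00 b2 b5; ring.
have qy : q ^+ 2 * y0 ^+ 2 * s00 = 1 by rewrite -yy; ring.
have fE : (1 + B 0 0) * (q * y0) = f.
  have : 2 * ((1 + B 0 0) * (q * y0)) * (q ^+ 2 * y0 ^+ 2 * s00) = 2 * f.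
    by rewrite -tyyy /bquad b2 b4; ring.
  by rewrite qy mulr1 => /mulfI; apply; rewrite pnatr_eq0.
have u0 : 0 <= (q * y0) ^+ 2 by exact: sqr_ge0.
have qy' : (q * y0) ^+ 2 * (B 0 3 * (1 + B 0 0 - B 0 3)) = 1 by rewrite -s00E -qy; ring.
rewrite -fE; move: (q * y0) u0 qy' => u u0 qy'.
(* Arithmetic-geometric inequality for B3 and 1 + B0 - B3: this square equals f^2 - 4. *)
have := sqr_ge0 (u * (1 + B 0 0 - 2 * B 0 3)).
have -> : (u * (1 + B 0 0 - 2 * B 0 3)) ^+ 2 =
  ((1 + B 0 0) * u) ^+ 2 - 4 * (u ^+ 2 * (B 0 3 * (1 + B 0 0 - B 0 3))) by ring.
by rewrite qy' mulr1 subr_ge0.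
Qed.

(** The combination has the shape of [hess_rhs], so that second derivatives of phi can be expanded
    inside [ricB]. *)
Lemma ricB_combl (B : 'rV[R]_6) (g0 g1 q x0 x1 x0' x1' u0 u1 y0 y1 : R) :
  ricB B (g0 * x0 + g1 * x0' - q * u0) (g0 * x1 + g1 * x1' - q * u1) y0 y1 =
  g0 * ricB B x0 x1 y0 y1 + g1 * ricB B x0' x1' y0 y1 - q * ricB B u0 u1 y0 y1.
Proof. rewrite /ricB /=; ring. Qed.

Lemma ricB_combr (B : 'rV[R]_6) (g0 g1 q x0 x1 x0' x1' u0 u1 y0 y1 : R) :
  ricB B y0 y1 (g0 * x0 + g1 * x0' - q * u0) (g0 * x1 + g1 * x1' - q * u1) =
  g0 * ricB B y0 y1 x0 x1 + g1 * ricB B y0 y1 x0' x1' - q * ricB B y0 y1 u0 u1.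
Proof. rewrite /ricB /=; ring. Qed.

Lemma nablaB_comb1 (B : 'rV[R]_6) (a b x0 x1 x0' x1' y0 y1 v0 v1 : R) :
  nablaB B (a * x0 + b * x0') (a * x1 + b * x1') y0 y1 v0 v1 =
  a * nablaB B x0 x1 y0 y1 v0 v1 + b * nablaB B x0' x1' y0 y1 v0 v1.
Proof. rewrite /nablaB /ricB /bquad /=; ring. Qed.

Lemma nablaB_comb2 (B : 'rV[R]_6) (a b x0 x1 x0' x1' y0 y1 v0 v1 : R) :
  nablaB B y0 y1 (a * x0 + b * x0') (a * x1 + b * x1') v0 v1 =
  a * nablaB B y0 y1 x0 x1 v0 v1 + b * nablaB B y0 y1 x0' x1' v0 v1.
Proof. rewrite /nablaB /ricB /bquad /=; ring. Qed.

Lemma nablaB_comb3 (B : 'rV[R]_6) (a b x0 x1 x0' x1' y0 y1 v0 v1 : R) :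
  nablaB B y0 y1 v0 v1 (a * x0 + b * x0') (a * x1 + b * x1') =
  a * nablaB B y0 y1 v0 v1 x0 x1 + b * nablaB B y0 y1 v0 v1 x0' x1'.
Proof. rewrite /nablaB /ricB /bquad /=; ring. Qed.

Lemma nablaB_comb (B : 'rV[R]_6) (u v u' v' u'' v'' P0 P1 Q0 Q1 : R) :
  nablaB B (u * P0 + v * P1) (u * Q0 + v * Q1) (u' * P0 + v' * P1) (u' * Q0 + v' * Q1)
    (u'' * P0 + v'' * P1) (u'' * Q0 + v'' * Q1) =
  u * (u' * (u'' * nablaB B P0 Q0 P0 Q0 P0 Q0 + v'' * nablaB B P0 Q0 P0 Q0 P1 Q1)
     + v' * (u'' * nablaB B P0 Q0 P1 Q1 P0 Q0 + v'' * nablaB B P0 Q0 P1 Q1 P1 Q1)) +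
  v * (u' * (u'' * nablaB B P1 Q1 P0 Q0 P0 Q0 + v'' * nablaB B P1 Q1 P0 Q0 P1 Q1)
     + v' * (u'' * nablaB B P1 Q1 P1 Q1 P0 Q0 + v'' * nablaB B P1 Q1 P1 Q1 P1 Q1)).
Proof. by rewrite nablaB_comb1 !nablaB_comb2 !nablaB_comb3. Qed.

(** Here u and v are the connection terms of [nablaB], and the w are coframe entries. The symbols g
    enter only through w o Gamma = f w (x) w, which yields f wk wi wj once for each of the two
    slots. *)
Lemma nablaB_pullback_arith (g0 g1 g0' g1' w0 w1 wk wi wj f q Pk s u v s0j s1j si0 si1 : R) :
  g0 * w0 + g1 * w1 = f * wk * wi -> g0' * w0 + g1' * w1 = f * wk * wj ->
  q ^+ 2 * s0j = w0 * wj -> q ^+ 2 * s1j = w1 * wj ->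
  q ^+ 2 * si0 = wi * w0 -> q ^+ 2 * si1 = wi * w1 ->
  q ^+ 3 * (2 * Pk * s) = q ^+ 2 * ((g0 * s0j + g1 * s1j - q * u)
     + (g0' * si0 + g1' * si1 - q * v)) ->
  q ^+ 3 * (2 * Pk * s + u + v) = 2 * f * wk * wi * wj.
Proof.
move=> e1 e2 e3 e4 e5 e6 e7.
transitivity (q ^+ 3 * (2 * Pk * s) + q ^+ 3 * u + q ^+ 3 * v); first by ring.
rewrite e7; transitivity (g0 * (q ^+ 2 * s0j) + g1 * (q ^+ 2 * s1j)
  + (g0' * (q ^+ 2 * si0) + g1' * (q ^+ 2 * si1))); first by ring.
rewrite e3 e4 e5 e6.
transitivity ((g0 * w0 + g1 * w1) * wj + (g0' * w0 + g1' * w1) * wi); first by ring.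
by rewrite e1 e2; ring.
Qed.

Lemma ricB_push_arith (B : 'rV[R]_6) (q w0 w1 u v u' v' P0 P1 Q0 Q1 : R) :
  q ^+ 2 * ricB B P0 Q0 P0 Q0 = w0 * w0 -> q ^+ 2 * ricB B P0 Q0 P1 Q1 = w0 * w1 ->
  q ^+ 2 * ricB B P1 Q1 P0 Q0 = w1 * w0 -> q ^+ 2 * ricB B P1 Q1 P1 Q1 = w1 * w1 ->
  q ^+ 2 * ricB B (u * P0 + v * P1) (u * Q0 + v * Q1) (u' * P0 + v' * P1) (u' * Q0 + v' * Q1)
  = (w0 * u + w1 * v) * (w0 * u' + w1 * v').
Proof.
move=> e00 e01 e10 e11.
transitivity (u * u' * (q ^+ 2 * ricB B P0 Q0 P0 Q0) + u * v' * (q ^+ 2 * ricB B P0 Q0 P1 Q1)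
  + v * u' * (q ^+ 2 * ricB B P1 Q1 P0 Q0) + v * v' * (q ^+ 2 * ricB B P1 Q1 P1 Q1)).
  rewrite /ricB /=; ring.
by rewrite e00 e01 e10 e11; ring.
Qed.

Lemma nablaB_push_arith (q f w0 w1 u v u' v' u'' v'' t000 t001 t010 t011 t100 t101 t110 t111 : R) :
  q * t000 = 2 * f * w0 * w0 * w0 -> q * t001 = 2 * f * w0 * w0 * w1 ->
  q * t010 = 2 * f * w0 * w1 * w0 -> q * t011 = 2 * f * w0 * w1 * w1 ->
  q * t100 = 2 * f * w1 * w0 * w0 -> q * t101 = 2 * f * w1 * w0 * w1 ->
  q * t110 = 2 * f * w1 * w1 * w0 -> q * t111 = 2 * f * w1 * w1 * w1 ->
  q * (u * (u' * (u'' * t000 + v'' * t001) + v' * (u'' * t010 + v'' * t011)) +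
       v * (u' * (u'' * t100 + v'' * t101) + v' * (u'' * t110 + v'' * t111))) =
  2 * f * (w0 * u + w1 * v) * (w0 * u' + w1 * v') * (w0 * u'' + w1 * v'').
Proof.
move=> e0 e1 e2 e3 e4 e5 e6 e7.
rewrite !mulrDr; rewrite ![q * (_ * _)]mulrCA.
by rewrite e0 e1 e2 e3 e4 e5 e6 e7; ring.
Qed.

(** One point, the origin, is enough: on the images of Z and Y under the differential of phi, the
    Ricci form of B and its covariant derivative take the values dictated by w(Z) = 0 and w(Y) =
    1. *)
Lemma adapted_admitsB_bound m A a c e f : adapted m A a c e f ->
  c * (f - c) + a * e = 1 -> admitsB m -> 4 <= f ^+ 2.
Proof.
move=> ad eps [B mB].
have [U [V [phi [psi [[oU U0] [oV Vpos] [UV VU psiK _] [sphi spsi] aff]]]]] := mB 0.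
have [D0 _] := ad.
have J0 := jacobian_neq0 oU oV UV psiK sphi spsi U0.
have q0 : (phi 0 0 0)^-1 != 0 by apply/invr_neq0/lt0r_neq0/Vpos/UV.
have pull i j := ricci_pullback oU oV Vpos UV psiK sphi spsi aff i j U0.
have dpull k i j := ricci_pullback_derive oU oV Vpos UV psiK sphi spsi aff k i j U0.
have cn k i j := typeB_connection k i j aff U0.
have ric i j := adapted_ricci i j ad.
have cof i j := adapted_coframe i j ad.
have [w0 w1] := coframe_dual D0.
have nab k i j : (phi 0 0 0)^-1 ^+ 3 *
  nablaB B (jac phi 0 k 0) (jac phi 1 k 0) (jac phi 0 i 0) (jac phi 1 i 0)
    (jac phi 0 j 0) (jac phi 1 j 0)
  = 2 * f * coframe A k * coframe A i * coframe A j.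
  have := dpull k i j; rewrite !cn /hess_rhs !GamE ricB_combl ricB_combr.
  have pl u v := esym (pull u v).
  move: (pl 0 j) (pl 1 j) (pl i 0) (pl i 1); rewrite !ric eps !mul1r.
  move: (cof k i) (cof k j); rewrite /nablaB.
  exact: nablaB_pullback_arith.
(* Component l of the differential of phi at the origin, applied to (u, v). *)
pose push u v l := u * jac phi l 0 0 + v * jac phi l 1 0.
have bil u v u' v' : (phi 0 0 0)^-1 ^+ 2 *
    ricB B (push u v 0) (push u v 1) (push u' v' 0) (push u' v' 1) =
    (coframe A 0 * u + coframe A 1 * v) * (coframe A 0 * u' + coframe A 1 * v').
  rewrite /push; have pl k l := esym (pull k l).
  move: (pl 0 0) (pl 0 1) (pl 1 0) (pl 1 1); rewrite !ric eps !mul1r.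
  exact: ricB_push_arith.
have tri u v u' v' u'' v'' : (phi 0 0 0)^-1 ^+ 3 *
    nablaB B (push u v 0) (push u v 1) (push u' v' 0) (push u' v' 1)
      (push u'' v'' 0) (push u'' v'' 1) =
    2 * f * (coframe A 0 * u + coframe A 1 * v) * (coframe A 0 * u' + coframe A 1 * v')
     * (coframe A 0 * u'' + coframe A 1 * v'').
  rewrite /push nablaB_comb.
  move: (nab 0 0 0) (nab 0 0 1) (nab 0 1 0) (nab 0 1 1)
    (nab 1 0 0) (nab 1 0 1) (nab 1 1 0) (nab 1 1 1).
  exact: nablaB_push_arith.
have q2 := expf_neq0 2 q0; have q3 := expf_neq0 3 q0.
apply: (@typeB_bound B (phi 0 0 0)^-1 f
  (push (A 0 0) (A 1 0) 0) (push (A 0 0) (A 1 0) 1)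
  (push (A 0 1) (A 1 1) 0) (push (A 0 1) (A 1 1) 1)) => //.
- have -> : push (A 0 0) (A 1 0) 0 * push (A 0 1) (A 1 1) 1
    - push (A 0 1) (A 1 1) 0 * push (A 0 0) (A 1 0) 1 =
    (A 0 0 * A 1 1 - A 0 1 * A 1 0) *
    (jac phi 0 0 0 * jac phi 1 1 0 - jac phi 0 1 0 * jac phi 1 0 0) by rewrite /push; ring.
  by rewrite mulf_neq0.
- by apply: (mulfI q2); rewrite bil w0 !(mulr0, mul0r).
- by apply: (mulfI q2); rewrite bil w0 !(mulr0, mul0r).
- by apply: (mulfI q2); rewrite bil w0 !(mulr0, mul0r).
- by rewrite bil w1 mulr1.
- by apply: (mulfI q3); rewrite tri w0 !(mulr0, mul0r).
- by apply: (mulfI q3); rewrite tri w0 !(mulr0, mul0r).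
- by apply: (mulfI q3); rewrite tri w0 !(mulr0, mul0r).
- by apply: (mulfI q3); rewrite tri w0 !(mulr0, mul0r).
- by rewrite tri w1 !mulr1.
Qed.

End Frames.

(** * Type B structures *)

Section Smooth.
Variable R : realType.
Implicit Types (U : set 'rV[R]_2) (f g : 'rV[R]_2 -> R).

(* A class of functions closed under partial derivatives, hence smooth. *)
Inductive elementary U : ('rV[R]_2 -> R) -> Prop :=
| elem_cst c : elementary U (fun=> c)
| elem_coord i : elementary U (fun y => y 0 i)
| elem_add f g : elementary U f -> elementary U g -> elementary U (fun y => f y + g y)
| elem_mul f g : elementary U f -> elementary U g -> elementary U (fun y => f y * g y)
| elem_exp f : elementary U f -> elementary U (fun y => expR (f y))
| elem_ln f : elementary U f -> (forall y, U y -> 0 < f y) ->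
    elementary U (fun y => ln (f y))
| elem_inv f : elementary U f -> (forall y, U y -> f y != 0) ->
    elementary U (fun y => (f y)^-1).

Lemma elementary_continuous U f x : elementary U f -> U x -> {for x, continuous f}.
Proof.
move=> fU Ux; elim: fU => {f} [c|i|f g _ cf _ cg|f g _ cf _ cg|f _ cf|f _ cf f0|f _ cf f0].
- exact: cst_continuous.
- exact: coord_continuous.
- exact: (continuousD cf cg).
- exact: (continuousM cf cg).
- by apply: (continuous_comp cf); exact: continuous_expR.
- by apply: (continuous_comp cf); apply: continuous_ln; exact: f0.
- by apply: (continuousV _ cf); exact: f0.
Qed.

Lemma elementary_derive U f i : elementary U f -> exists2 g, elementary U g &
  forall x, U x -> is_derive x (ev R i) f (g x).
Proof.
elim=> {f} [c|j|f g fU [f' f'U fd] gU [g' g'U gd]|f g fU [f' f'U fd] gU [g' g'U gd]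
    |f fU [f' f'U fd]|f fU [f' f'U fd] f0|f fU [f' f'U fd] f0].
- exists (fun=> 0); first exact: elem_cst.
  by move=> x _; exact: is_derive_cst.
- exists (fun=> ev R i 0 j); first exact: elem_cst.
  by move=> x _; exact: is_derive_coord.
- exists (fun y => f' y + g' y); first exact: elem_add.
  by move=> x Ux; have := fd x Ux; have := gd x Ux => ? ?; exact: is_deriveD.
- exists (fun y => f y * g' y + g y * f' y).
    by apply: elem_add; exact: elem_mul.
  by move=> x Ux; have := fd x Ux; have := gd x Ux => ? ?; exact: is_deriveM.
- exists (fun y => expR (f y) * f' y); first by apply: elem_mul => //; exact: elem_exp.
  by move=> x Ux; apply: is_derive_comp1 (fd x Ux) _; exact: is_derive_expR.
- exists (fun y => (f y)^-1 * f' y).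
    by apply: elem_mul => //; apply: elem_inv => // y /f0/lt0r_neq0.
  by move=> x Ux; apply: is_derive_comp1 (fd x Ux) _; exact/is_derive1_ln/f0.
- exists (fun y => (-1) * ((f y)^-1 * (f y)^-1) * f' y).
    have ei : elementary U (fun y => (f y)^-1) by exact: elem_inv.
    by apply: elem_mul => //; apply: elem_mul; [exact: elem_cst|exact: elem_mul].
  move=> x Ux; have h := fd x Ux; apply: DeriveDef.
    by apply: derivableV; [exact: f0|exact: ex_derive].
  rewrite deriveV; [|exact: f0|exact: ex_derive].
  by rewrite derive_val /GRing.scale /= mulN1r expr2 invfM.
Qed.

(** Each iterated derivative agrees with an elementary function on U only; openness of U is what
    transfers derivability and continuity. *)
Lemma elementary_smooth U f : open U -> elementary U f -> smooth_on U f.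
Proof.
move=> oU fU l.
have [g gU gE] : exists2 g, elementary U g & forall x, U x -> dpart l f x = g x.
  elim: l => [|i l [g gU gE]] /=; first by exists f.
  have [g' g'U gd] := elementary_derive i gU; exists g' => // x Ux.
  rewrite -(@derive_val _ _ _ _ _ _ _ (gd x Ux)); apply: near_eq_derive.
  have : nbhs x U by exact: open_nbhs_nbhs.
  by apply: filterS => y Uy; exact: gE.
move=> x Ux; have nU : nbhs x U by exact: open_nbhs_nbhs.
have nE : {near x, g =1 dpart l f} by apply: filterS nU => y Uy; rewrite gE.
split.
  move=> i; have [g' _ gd] := elementary_derive i gU.
  by apply: (near_eq_derivable nE); have [] := gd x Ux.
rewrite /prop_for /continuous_at gE//.
have := elementary_continuous gU Ux; apply: cvg_trans.
exact: near_eq_cvg nE.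
Qed.

End Smooth.

(** * Explicit affine maps to Type B models *)

Section Existence.
Variable R : realType.
Implicit Types (m : 'rV[R]_6) (A : 'M[R]_2).

(** The first row of the inverse of A, that is the differential of the coordinate alpha dual to
    Z. *)
Definition coframe1 A (i : 'I_2) : R :=
  (if i == 0 then A 1 1 else - A 0 1) / (A 0 0 * A 1 1 - A 0 1 * A 1 0).

Lemma adapted_coframe1 m A a c e f i j : adapted m A a c e f ->
  Gam m i j 0 * coframe1 A 0 + Gam m i j 1 * coframe1 A 1 =
  a * coframe1 A i * coframe1 A j
  + c * (coframe1 A i * coframe A j + coframe A i * coframe1 A j)
  + e * coframe A i * coframe A j.
Proof.
move=> h; have [D0 _] := h.
have [] := adapted_conn h 0; have [] := adapted_conn h 1; rewrite !GamE.
move=> m1 m3 m5 m0 m2 m4.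
by elim/ord2_ind: i; elim/ord2_ind: j;
  rewrite !GamE ?m0 ?m1 ?m2 ?m3 ?m4 ?m5 /coframe /coframe1 /=;
  move: (A 0 0) (A 0 1) (A 1 0) (A 1 1) D0 {h m0 m1 m2 m3 m4 m5} => z0 y0 z1 y1 D0; field.
Qed.

Definition lin (w : 'I_2 -> R) (x : 'rV[R]_2) : R := w 0 * x 0 0 + w 1 * x 0 1.

Lemma elementary_lin U w : elementary U (lin w).
Proof.
by apply: elem_add; apply: elem_mul; first [exact: elem_cst|exact: elem_coord].
Qed.

Lemma is_derive_lin w x i : is_derive x (ev R i) (lin w) (w i).
Proof.
have h := is_deriveD (is_deriveZ (w 0) (is_derive_coord x (ev R i) 0))
                     (is_deriveZ (w 1) (is_derive_coord x (ev R i) 1)).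
apply: (is_derive_eq h); rewrite !ev_coord /GRing.scale /=.
by elim/ord2_ind: i {h}; rewrite /= ?mulr1 ?mulr0 ?addr0 ?add0r.
Qed.

Lemma frame_decomposition A (x : 'rV[R]_2) k : A 0 0 * A 1 1 - A 0 1 * A 1 0 != 0 ->
  A k 0 * lin (coframe1 A) x + A k 1 * lin (coframe A) x = x 0 k.
Proof.
by move=> D0; rewrite /lin /coframe /coframe1 /=; elim/ord2_ind: k; field.
Qed.

Lemma frame_coordinates A (u v : R) (x : 'rV[R]_2) : A 0 0 * A 1 1 - A 0 1 * A 1 0 != 0 ->
  (forall k, x 0 k = A k 0 * u + A k 1 * v) ->
  lin (coframe1 A) x = u /\ lin (coframe A) x = v.
Proof.
by move=> D0 h; rewrite /lin !h /coframe /coframe1 /=; split; field.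
Qed.

(* In the coordinates (exp beta, h), where beta is the linear function with
   differential [coframe A], a model with an adapted frame is of Type B with
   only A_11^1 = f - 1 and A_12^2 = c nonzero, provided that h satisfies the
   second order equation below. *)
Lemma admitsB_intro m A a c e f (h : 'rV[R]_2 -> R) (h1 : 'I_2 -> 'rV[R]_2 -> R)
    (h2 : 'I_2 -> 'I_2 -> 'rV[R]_2 -> R) (V : set 'rV[R]_2) (s : 'rV[R]_2 -> R) :
  adapted m A a c e f ->
  elementary setT h -> elementary V s -> open V -> V `<=` @half_plane R ->
  let phi x := (\row_k (if k == 0 then expR (lin (coframe A) x) else h x)) : 'rV[R]_2 in
  (forall x, V (phi x)) -> (forall x, s (phi x) = lin (coframe1 A) x) ->
  (forall x y, V y -> lin (coframe1 A) x = s y -> lin (coframe A) x = ln (y 0 0) ->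
     h x = y 0 1) ->
  (forall x i, is_derive x (ev R i) h (h1 i x)) ->
  (forall x i j, is_derive x (ev R i) (h1 j) (h2 i j x)) ->
  (forall x i j, h2 i j x + c * (coframe A i * h1 j x + h1 i x * coframe A j) =
     Gam m i j 0 * h1 0 x + Gam m i j 1 * h1 1 x) ->
  admitsB m.
Proof.
move=> ad hE sE oV Vpos phi Vphi sphi hs hd hdd eqh; have [D0 _] := ad.
pose P := fun x => expR (lin (coframe A) x).
have phi0 : (fun x => phi x 0 0) = P by apply/funext => x; rewrite /phi mxE.
have phi1 : (fun x => phi x 0 1) = h by apply/funext => x; rewrite /phi mxE.
have PE : elementary setT P by apply: elem_exp; exact: elementary_lin.
have Pd x i : is_derive x (ev R i) P (P x * coframe A i).
  exact: is_derive_comp1 (is_derive_lin _ x i) (is_derive_expR _).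
have dP i : dpart [:: i] P = (fun x => P x * coframe A i).
  by apply/funext => x; rewrite /= derive_val.
have dh i : dpart [:: i] h = h1 i.
  by apply/funext => x; rewrite /= (@derive_val _ _ _ _ _ _ _ (hd x i)).
have ddP i j x : dpart [:: i; j] P x = P x * coframe A i * coframe A j.
  rewrite -[LHS]/(derive (dpart [:: j] P) x (ev R i)) dP.
  have d := is_deriveM (Pd x i) (is_derive_cst (coframe A j) x (ev R i)).
  rewrite (@derive_val _ _ _ _ _ _ _ d) /GRing.scale /=; ring.
have ddh i j x : dpart [:: i; j] h x = h2 i j x.
  rewrite -[LHS]/(derive (dpart [:: j] h) x (ev R i)) dh.
  exact: (@derive_val _ _ _ _ _ _ _ (hdd x i j)).
(* The equation for exp beta reads 1 + B0 = f. In the equation for h the factor exp beta cancels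
   from the mixed term, leaving the coefficient B3 = c. *)
pose B : 'rV[R]_6 := \row_l (if l == 0 then f - 1 else if l == 3 then c else 0).
have B0 : B 0 0 = f - 1 by rewrite mxE.
have B1 : B 0 1 = 0 by rewrite mxE.
have B2 : B 0 2 = 0 by rewrite mxE.
have B3 : B 0 3 = c by rewrite mxE.
have B4 : B 0 4 = 0 by rewrite mxE.
have B5 : B 0 5 = 0 by rewrite mxE.
exists B => p.
(* On V, [s] and ln y^1 are the coordinates alpha and beta of the preimage. As phi is defined on the
   whole plane, one chart serves every p. *)
pose psi y : 'rV[R]_2 := \row_k (A k 0 * s y + A k 1 * ln (y 0 0)).
have psiE y k : psi y 0 k = A k 0 * s y + A k 1 * ln (y 0 0) by rewrite mxE.
have phiE0 x : phi x 0 0 = P x by rewrite -phi0.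
have phiE1 x : phi x 0 1 = h x by rewrite -phi1.
exists setT, V, phi, psi; split.
- by split; [exact: openT|].
- by [].
- split => // [x _|y Vy].
    by apply/rowP => k; rewrite psiE sphi phiE0 expRK frame_decomposition.
  have [e1 e2] := frame_coordinates D0 (psiE y).
  apply/rowP; apply: ord2_ind.
    by rewrite phiE0 /P e2 lnK// posrE; exact: Vpos.
  by rewrite phiE1; exact: hs.
- split; apply: ord2_ind.
  + by rewrite phi0; apply: elementary_smooth => //; exact: openT.
  + by rewrite phi1; apply: elementary_smooth => //; exact: openT.
  + apply: elementary_smooth => //; rewrite (funext (psiE^~ 0)).
    apply: elem_add; apply: elem_mul => //; try exact: elem_cst.
    by apply: elem_ln; [exact: elem_coord|exact: Vpos].
  + apply: elementary_smooth => //; rewrite (funext (psiE^~ 1)).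
    apply: elem_add; apply: elem_mul => //; try exact: elem_cst.
    by apply: elem_ln; [exact: elem_coord|exact: Vpos].
- move=> x _ i j; apply: ord2_ind => phik; rewrite /phik !sum2E /GamB !GamE.
    rewrite phi0 phi1 !dP !dh ddP B0 B2 B4 phiE0.
    have P0 : P x != 0 by apply/lt0r_neq0/expR_gt0.
    have cof := adapted_coframe i j ad.
    transitivity (P x * (f * coframe A i * coframe A j)); first by field.
    by rewrite -cof; ring.
  rewrite phi0 phi1 !dP !dh ddh B1 B3 B5 phiE0 -eqh.
  have P0 : P x != 0 by apply/lt0r_neq0/expR_gt0.
  by field.
Qed.

Lemma open_gt0_coord (i : 'I_2) : open [set y : 'rV[R]_2 | 0 < y 0 i].
Proof.
have -> : [set y : 'rV[R]_2 | 0 < y 0 i] = (fun y : 'rV[R]_2 => y 0 i) @^-1` [set t | 0 < t].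
  by [].
apply: open_comp; last exact: open_gt.
by move=> y _; exact: coord_continuous.
Qed.

(** For h = alpha + e/2 beta^2 the equation of [admitsB_intro] fails by e (f - 2 c) beta w (x) w,
    which the second hypothesis annihilates. *)
Lemma admitsB_flat_kernel m A c e f : adapted m A 0 c e f -> e * (f - 2 * c) = 0 ->
  admitsB m.
Proof.
move=> ad ef.
pose al := lin (coframe1 A); pose be := lin (coframe A).
have ald x i : is_derive x (ev R i) al (coframe1 A i) by exact: is_derive_lin.
have bed x i : is_derive x (ev R i) be (coframe A i) by exact: is_derive_lin.
apply: (@admitsB_intro m A 0 c e f (fun x => al x + e / 2 * (be x * be x))
  (fun i x => coframe1 A i + e * (be x * coframe A i))
  (fun i j x => e * (coframe A i * coframe A j)) (@half_plane R)
  (fun y => y 0 1 + (- (e / 2)) * (ln (y 0 0) * ln (y 0 0)))) => //.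
- apply: elem_add; first exact: elementary_lin.
  apply: elem_mul; first exact: elem_cst.
  by apply: elem_mul; exact: elementary_lin.
- have ln0 : elementary (@half_plane R) (fun y => ln (y 0 0)).
    by apply: elem_ln => //; exact: elem_coord.
  apply: elem_add; first exact: elem_coord.
  by apply: elem_mul; [exact: elem_cst|exact: elem_mul].
- exact: open_gt0_coord.
- by move=> x; rewrite /half_plane /= mxE; exact: expR_gt0.
- by move=> x; rewrite !mxE /= expRK -/(al x) -/(be x); ring.
- by move=> x y _ ea eb; rewrite /al /be ea eb; ring.
- move=> x i.
  have d := is_deriveD (ald x i) (is_deriveZ (e / 2) (is_deriveM (bed x i) (bed x i))).
  by apply: (is_derive_eq d); rewrite /GRing.scale /=; field.
- move=> x i j.
  have d := is_deriveD (is_derive_cst (coframe1 A j) x (ev R i)) (is_deriveZ e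
   (is_deriveM (bed x i) (is_derive_cst (coframe A j) x (ev R i)))).
  by apply: (is_derive_eq d); rewrite /GRing.scale /=; ring.
- move=> x i j /=.
  have cof := adapted_coframe i j ad; have cof1 := adapted_coframe1 i j ad.
  transitivity ((Gam m i j 0 * coframe1 A 0 + Gam m i j 1 * coframe1 A 1)
    + e * be x * (Gam m i j 0 * coframe A 0 + Gam m i j 1 * coframe A 1)); last by ring.
  rewrite cof cof1; apply/eqP; rewrite eq_sym -subr_eq0.
  have -> : (0 * coframe1 A i * coframe1 A j + c * (coframe1 A i * coframe A j
     + coframe A i * coframe1 A j) + e * coframe A i * coframe A j
     + e * be x * (f * coframe A i * coframe A j) - (e * (coframe A i * coframe A j) +
    c * (coframe A i * (coframe1 A j + e * (be x * coframe A j)) +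
    (coframe1 A i + e * (be x * coframe A i)) * coframe A j))) =
    e * (f - 2 * c) * (be x * coframe A i * coframe A j) by ring.
  by rewrite ef mul0r.
Qed.

(** For h = exp (a alpha) and e = 0, the equation of [admitsB_intro] is [adapted_coframe1]
    multiplied by a h. The image is the quadrant where both coordinates are positive. *)
Lemma admitsB_geodesic_transversal m A a c f : a != 0 -> adapted m A a c 0 f ->
  admitsB m.
Proof.
move=> a0 ad.
pose al := lin (coframe1 A); pose be := lin (coframe A).
pose E x := expR (a * al x).
have ald x i : is_derive x (ev R i) al (coframe1 A i) by exact: is_derive_lin.
have Ed x i : is_derive x (ev R i) E (E x * (a * coframe1 A i)).
  exact: is_derive_comp1 (is_deriveZ a (ald x i)) (is_derive_expR _).
apply: (@admitsB_intro m A a c 0 f E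
  (fun i x => E x * (a * coframe1 A i))
  (fun i j x => E x * (a * coframe1 A i) * (a * coframe1 A j))
  ([set y : 'rV[R]_2 | 0 < y 0 0] `&` [set y | 0 < y 0 1]) (fun y => a^-1 * ln (y 0 1))) => //.
- by apply: elem_exp; apply: elem_mul; [exact: elem_cst|exact: elementary_lin].
- apply: elem_mul; first exact: elem_cst.
  by apply: elem_ln; [exact: elem_coord|move=> y []].
- by apply: openI; exact: open_gt0_coord.
- by move=> x; split; rewrite /= mxE /=; exact: expR_gt0.
- by move=> x; rewrite !mxE /= /E expRK mulKf.
- by move=> x y [_ y1] ea eb; rewrite /E /al ea mulVKf// lnK.
- move=> x i j.
  have d := is_deriveM (Ed x i) (is_derive_cst (a * coframe1 A j) x (ev R i)).
  by apply: (is_derive_eq d); rewrite /GRing.scale /=; ring.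
- move=> x i j /=.
  have cof1 := adapted_coframe1 i j ad.
  transitivity (E x * a * (Gam m i j 0 * coframe1 A 0 + Gam m i j 1 * coframe1 A 1));
    last by ring.
  by rewrite cof1; ring.
Qed.

(** The new frame is s Z, v Y + u Z. As v is 1 or -1, w changes at most by sign and c (f - c) + a e
    is preserved; v serves to choose the orientation. *)
Lemma adapted_change m A a c e f (s u v : R) : s != 0 -> v * v = 1 ->
  adapted m A a c e f ->
  adapted m (\matrix_(k, l) (if l == 0 then s * A k 0 else v * A k 1 + u * A k 0))
    (s * a) (v * c + u * a) ((e + 2 * v * u * c + u ^+ 2 * a - f * v * u) / s) (v * f).
Proof.
move=> s0 vv [D0 h]; rewrite /adapted !mxE /=; split.
  have -> : s * A 0 0 * (v * A 1 1 + u * A 1 0) - (v * A 0 1 + u * A 0 0) * (s * A 1 0) =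
    s * v * (A 0 0 * A 1 1 - A 0 1 * A 1 0) by ring.
  have v0 : v != 0 by apply/eqP => v0; move: vv; rewrite v0 mulr0 => /eqP; rewrite eq_sym oner_eq0.
  by rewrite !mulf_neq0.
move=> k; have [h1 h2 h3] := h k; rewrite !mxE /=.
have comb x0 x1 y0 y1 (p q p' q' : R) :
  conn m k (p * x0 + q * y0) (p * x1 + q * y1) (p' * x0 + q' * y0) (p' * x1 + q' * y1) =
  p * p' * conn m k x0 x1 x0 x1 + (p * q' + q * p') * conn m k x0 x1 y0 y1
  + q * q' * conn m k y0 y1 y0 y1 by rewrite /conn /bquad; ring.
have c1 := comb (A 0 0) (A 1 0) (A 0 1) (A 1 1) s 0 s 0.
have c2 := comb (A 0 0) (A 1 0) (A 0 1) (A 1 1) s 0 u v.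
have c3 := comb (A 0 0) (A 1 0) (A 0 1) (A 1 1) u v u v.
move: c1 c2 c3; rewrite h1 h2 h3 !mul0r !addr0 ![u * _ + v * _]addrC.
move=> -> -> ->; split; first by ring.
  by ring.
transitivity (u * u * (a * A k 0) + (v * u + u * v) * (c * A k 0)
  + (v * v) * (e * A k 0 + f * A k 1)); first by [].
rewrite vv mul1r.
transitivity ((e + 2 * v * u * c + u ^+ 2 * a - f * v * u) * A k 0
   + v * f * u * A k 0 + (v * v) * f * A k 1); first by rewrite vv; ring.
by field.
Qed.

(** A shear by u kills e when a u^2 - (f - 2 c) u + e = 0, whose discriminant is f^2 - 4 (c (f - c)
    + a e). For a = 0 the equation is linear, and if also f = 2 c then [admitsB_flat_kernel] applies
    without a shear. *)
Lemma admitsB_bound m A a c e f : adapted m A a c e f ->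
  4 * (c * (f - c) + a * e) <= f ^+ 2 -> admitsB m.
Proof.
move=> ad bound.
have one : (1 : R) * 1 = 1 by rewrite mulr1.
have [a0|a0] := eqVneq a 0.
  have [fc|fc] := eqVneq (f - 2 * c) 0.
    by rewrite a0 in ad; apply: (admitsB_flat_kernel ad); rewrite fc mulr0.
  have := adapted_change (e / (f - 2 * c)) (oner_neq0 R) one ad.
  rewrite a0 !mulr0 !addr0 !mulr1 !mul1r.
  have -> : (e + 2 * (e / (f - 2 * c)) * c - f * (e / (f - 2 * c))) / 1 = 0 by field.
  by move=> /admitsB_flat_kernel; apply; rewrite mul0r.
pose disc := (f - 2 * c) ^+ 2 - 4 * a * e.
have disc0 : 0 <= disc.
  rewrite /disc -subr_ge0 in bound *.
  by move: bound; congr (_ <= _); ring.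
pose u := (f - 2 * c + Num.sqrt disc) / (2 * a).
have := adapted_change u (oner_neq0 R) one ad.
have -> : (e + 2 * 1 * u * c + u ^+ 2 * a - f * 1 * u) / 1 = 0.
  have : Num.sqrt disc ^+ 2 = disc by rewrite sqr_sqrtr.
  rewrite /u /disc; move: (Num.sqrt _) => r rE.
  transitivity ((r ^+ 2 - ((f - 2 * c) ^+ 2 - 4 * a * e)) / (4 * a)); first by field.
  by rewrite rE subrr mul0r.
by apply: admitsB_geodesic_transversal; rewrite mul1r.
Qed.

End Existence.

(** * The action on frames *)

Section Action.
Variable R : realType.
Implicit Types (m n : 'rV[R]_6) (A : 'M[R]_2).

Lemma row6P m n : m 0 0 = n 0 0 -> m 0 1 = n 0 1 -> m 0 2 = n 0 2 ->
  m 0 3 = n 0 3 -> m 0 4 = n 0 4 -> m 0 5 = n 0 5 -> m = n.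
Proof.
move=> e0 e1 e2 e3 e4 e5; apply/rowP => l.
case: l => [[|[|[|[|[|[|//]]]]]] i];
  [move: e0|move: e1|move: e2|move: e3|move: e4|move: e5];
  by congr (m 0 _ = n 0 _); exact/val_inj.
Qed.

Definition row6 (a b c d e f : R) : 'rV[R]_6 := \row_l nth 0 [:: a; b; c; d; e; f] l.

Lemma row6E a b c d e f :
  (row6 a b c d e f 0 0 = a) * (row6 a b c d e f 0 1 = b) * (row6 a b c d e f 0 2 = c) *
  (row6 a b c d e f 0 3 = d) * (row6 a b c d e f 0 4 = e) * (row6 a b c d e f 0 5 = f).
Proof. by rewrite /row6 !mxE. Qed.

Lemma det2 A : \det A = A 0 0 * A 1 1 - A 0 1 * A 1 0.
Proof.
rewrite (expand_det_row _ 0) sum2E /cofactor !det_mx11 !mxE /= expr0 expr1 mul1r mulN1r mulrN.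
by congr (_ * A _ _ - _ * A _ _); exact/val_inj.
Qed.

Lemma invmx2 A : A 0 0 * A 1 1 - A 0 1 * A 1 0 != 0 ->
  [/\ invmx A 0 0 = A 1 1 / (A 0 0 * A 1 1 - A 0 1 * A 1 0),
      invmx A 0 1 = - A 0 1 / (A 0 0 * A 1 1 - A 0 1 * A 1 0),
      invmx A 1 0 = - A 1 0 / (A 0 0 * A 1 1 - A 0 1 * A 1 0) &
      invmx A 1 1 = A 0 0 / (A 0 0 * A 1 1 - A 0 1 * A 1 0)].
Proof.
move=> D0.
have uA : A \in unitmx by rewrite unitmxE det2 unitfE.
pose C : 'M[R]_2 := \matrix_(i, j) ((if i == 0 then (if j == 0 then A 1 1 else - A 0 1)
   else if j == 0 then - A 1 0 else A 0 0) / (A 0 0 * A 1 1 - A 0 1 * A 1 0)).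
have AC : A *m C = 1%:M.
  apply/matrixP => i j; rewrite mxE sum2E !mxE /=.
  by elim/ord2_ind: i; elim/ord2_ind: j; rewrite /=; field.
have -> : invmx A = C by rewrite -[LHS]mulmx1 -AC mulKmx.
by rewrite !mxE.
Qed.

Lemma Gam_mkA (G : 'I_2 -> 'I_2 -> 'I_2 -> R) i j k :
  (forall u v w, G u v w = G v u w) -> Gam (mkA G) i j k = G i j k.
Proof.
move=> Gsym.
have i0 : inord 0 = 0 :> 'I_2 by apply/val_inj; rewrite /= inordK.
have i1 : inord 1 = 1 :> 'I_2 by apply/val_inj; rewrite /= inordK.
by elim/ord2_ind: i; elim/ord2_ind: j; elim/ord2_ind: k;
  rewrite GamE /mkA mxE /= ?i0 ?i1 // Gsym.
Qed.

Lemma Gam_actA A n i j k : A 0 0 * A 1 1 - A 0 1 * A 1 0 != 0 ->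
  Gam (actA A n) i j k = \sum_(u < 2) \sum_(v < 2) \sum_(w < 2)
    A k u * Gam n v w u * invmx A v i * invmx A w j.
Proof.
move=> D0; rewrite /actA Gam_mkA// => u v w.
apply: eq_bigr => l _; rewrite exchange_big /=.
apply: eq_bigr => p _; apply: eq_bigr => q _.
by rewrite /Gam [(p + q)%N]addnC -!mulrA; congr (_ * (_ * _)); rewrite mulrC.
Qed.

(** Under linear changes of coordinates the Christoffel symbols are tensorial: A intertwines the two
    connections. *)
Lemma conn_actA A n k x0 x1 y0 y1 : A 0 0 * A 1 1 - A 0 1 * A 1 0 != 0 ->
  conn (actA A n) k (A 0 0 * x0 + A 0 1 * x1) (A 1 0 * x0 + A 1 1 * x1)
     (A 0 0 * y0 + A 0 1 * y1) (A 1 0 * y0 + A 1 1 * y1) =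
  A k 0 * conn n 0 x0 x1 y0 y1 + A k 1 * conn n 1 x0 x1 y0 y1.
Proof.
move=> D0; rewrite /conn !(Gam_actA _ _ _ _ D0) !sum2E.
have [-> -> -> ->] := invmx2 D0.
rewrite /bquad !GamE; move: (A k 0) (A k 1) => p q.
move: (A 0 0) (A 0 1) (A 1 0) (A 1 1) D0 => z0 y0' z1 y1' D0.
by field.
Qed.

(** The entries of n are the Christoffel symbols of m in the frame of columns of A. This is m = actA
    A n (see [framedP]) free of inverse matrices, and [adapted] is the case n 0 1 = n 0 3 = 0. *)
Definition framed m A n : Prop :=
  A 0 0 * A 1 1 - A 0 1 * A 1 0 != 0 /\
  forall k, [/\
   conn m k (A 0 0) (A 1 0) (A 0 0) (A 1 0) = n 0 0 * A k 0 + n 0 1 * A k 1,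
   conn m k (A 0 0) (A 1 0) (A 0 1) (A 1 1) = n 0 2 * A k 0 + n 0 3 * A k 1 &
   conn m k (A 0 1) (A 1 1) (A 0 1) (A 1 1) = n 0 4 * A k 0 + n 0 5 * A k 1].

Lemma framed_inj m m' A n : framed m A n -> framed m' A n -> m = m'.
Proof.
move=> [D0 h] [_ h'].
have E k : [/\ Gam m 0 0 k = Gam m' 0 0 k, Gam m 0 1 k = Gam m' 0 1 k &
               Gam m 1 1 k = Gam m' 1 1 k].
  have [a1 a2 a3] := h k; have [b1 b2 b3] := h' k.
  have [-> -> ->] := bquad_solve D0 a1 a2 a3.
  by have [-> -> ->] := bquad_solve D0 b1 b2 b3.
have [e0 e2 e4] := E 0; have [e1 e3 e5] := E 1.
by move: e0 e1 e2 e3 e4 e5; rewrite !GamE => *; exact: row6P.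
Qed.

Lemma framed_actA m A (B : 'M[R]_2) n : B 0 0 * B 1 1 - B 0 1 * B 1 0 != 0 -> framed m A n ->
  framed (actA B m) (B *m A) n.
Proof.
move=> D0 [DA h]; rewrite /framed !mxE !sum2E; split.
  have -> : (B 0 0 * A 0 0 + B 0 1 * A 1 0) * (B 1 0 * A 0 1 + B 1 1 * A 1 1) -
    (B 0 0 * A 0 1 + B 0 1 * A 1 1) * (B 1 0 * A 0 0 + B 1 1 * A 1 0) =
    (B 0 0 * B 1 1 - B 0 1 * B 1 0) * (A 0 0 * A 1 1 - A 0 1 * A 1 0) by ring.
  by rewrite mulf_neq0.
move=> k; rewrite !mxE !sum2E !(conn_actA _ _ _ _ _ _ D0).
have [-> -> ->] := h 0; have [-> -> ->] := h 1.
by split; ring.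
Qed.

Lemma framed_std n : framed n 1%:M n.
Proof.
rewrite /framed !mxE /=; split; first by rewrite mulr1 mulr0 subr0 oner_neq0.
by elim/ord2_ind; rewrite /conn /bquad !GamE !mxE /=; split; ring.
Qed.

(** A carries the standard frame of n to a frame of [actA A n], and a frame with its symbols
    determines the model. *)
Lemma framedP m A n : A 0 0 * A 1 1 - A 0 1 * A 1 0 != 0 ->
  framed m A n <-> m = actA A n.
Proof.
move=> D0; have h := framed_actA D0 (framed_std n); rewrite mulmx1 in h.
by split=> [hm|->//]; exact: framed_inj hm h.
Qed.

Lemma framed_exists m A : A 0 0 * A 1 1 - A 0 1 * A 1 0 != 0 -> exists n, framed m A n.
Proof.
move=> D0.
(* Cramer's rule: p and q are the coordinates of (u, v) in the basis of columns of A. *)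
pose p (u v : R) := (u * A 1 1 - v * A 0 1) / (A 0 0 * A 1 1 - A 0 1 * A 1 0).
pose q (u v : R) := (- u * A 1 0 + v * A 0 0) / (A 0 0 * A 1 1 - A 0 1 * A 1 0).
pose c k := (conn m k (A 0 0) (A 1 0) (A 0 0) (A 1 0)).
pose d k := (conn m k (A 0 0) (A 1 0) (A 0 1) (A 1 1)).
pose e k := (conn m k (A 0 1) (A 1 1) (A 0 1) (A 1 1)).
exists (row6 (p (c 0) (c 1)) (q (c 0) (c 1)) (p (d 0) (d 1)) (q (d 0) (d 1))
             (p (e 0) (e 1)) (q (e 0) (e 1))).
have pq (F : 'I_2 -> R) k : F k = p (F 0) (F 1) * A k 0 + q (F 0) (F 1) * A k 1.
  by rewrite /p /q; elim/ord2_ind: k; field.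
by split=> // k; rewrite !row6E; split; [exact: (pq c)|exact: (pq d)|exact: (pq e)].
Qed.

Lemma framed_adapted m A a c e f :
  adapted m A a c e f <-> framed m A (row6 a 0 c 0 e f).
Proof.
by split=> -[D0 h]; split=> // k; have := h k; rewrite !row6E !mul0r !addr0.
Qed.

Lemma framed_ricci m A n k l : framed m A n ->
  A 0 k * A 0 l * ricciA m 0 0 + A 0 k * A 1 l * ricciA m 0 1
  + A 1 k * A 0 l * ricciA m 1 0 + A 1 k * A 1 l * ricciA m 1 1 = ricciA n k l.
Proof.
move=> [D0 h].
have [a1 a2 a3] := h 0; have [b1 b2 b3] := h 1.
have [] := bquad_solve D0 a1 a2 a3; have [] := bquad_solve D0 b1 b2 b3.
rewrite !GamE => m1 m3 m5 m0 m2 m4.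
by elim/ord2_ind: k; elim/ord2_ind: l; rewrite !ricciAE m0 m1 m2 m3 m4 m5;
  move: (A 0 0) (A 0 1) (A 1 0) (A 1 1) D0
    {h m0 m1 m2 m3 m4 m5 a1 a2 a3 b1 b2 b3} => z0 y0 z1 y1 D0; field.
Qed.

(** Take Z = (- w1, w0), spanning the kernel of w, and Y = w / |w|^2. In this frame the Ricci matrix
    r of n has r11 = eps and zeros elsewhere. *)
Lemma adapted_exists m (eps w0 w1 : R) : eps != 0 -> w0 ^+ 2 + w1 ^+ 2 != 0 ->
  ricciA m 0 0 = eps * w0 * w0 -> ricciA m 0 1 = eps * w0 * w1 ->
  ricciA m 1 1 = eps * w1 * w1 ->
  exists A a c e f, adapted m A a c e f /\ c * (f - c) + a * e = eps.
Proof.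
move=> eps0 w20 r00 r01 r11.
have r10 : ricciA m 1 0 = eps * w0 * w1 by rewrite -r01 !ricciAE.
pose A : 'M[R]_2 := \matrix_(i, j) (if j == 0 then if i == 0 then - w1 else w0
   else (if i == 0 then w0 else w1) / (w0 ^+ 2 + w1 ^+ 2)).
have A00 : A 0 0 = - w1 by rewrite mxE.
have A10 : A 1 0 = w0 by rewrite mxE.
have A01 : A 0 1 = w0 / (w0 ^+ 2 + w1 ^+ 2) by rewrite mxE.
have A11 : A 1 1 = w1 / (w0 ^+ 2 + w1 ^+ 2) by rewrite mxE.
have D0 : A 0 0 * A 1 1 - A 0 1 * A 1 0 != 0.
  have -> : A 0 0 * A 1 1 - A 0 1 * A 1 0 = -1 by rewrite A00 A10 A01 A11; field.
  by rewrite oppr_eq0 oner_neq0.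
have [n fn] := framed_exists m D0.
have n00 := framed_ricci 0 0 fn; have n01 := framed_ricci 0 1 fn.
have n11 := framed_ricci 1 1 fn.
move: n00 n01 n11; rewrite r00 r01 r10 r11 A00 A10 A01 A11 !ricciAE => n00 n01 n11.
have e00 : (n 0 0 - n 0 3) * n 0 3 + n 0 1 * (n 0 5 - n 0 2) = 0 by rewrite -n00; ring.
have e01 : n 0 2 * n 0 3 - n 0 1 * n 0 4 = 0 by rewrite -n01; field.
have e11 : n 0 2 * (n 0 5 - n 0 2) + (n 0 0 - n 0 3) * n 0 4 = eps by rewrite -n11; field.
(* With n = (a, b, c, d, e, f), b r11 = c r00 - (a - d) r01, and for the next step d r11 = e r00 +
   (f - c) r01. *)
have n1 : n 0 1 = 0.
  apply: (mulIf eps0); rewrite mul0r -e11.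
  transitivity (n 0 2 * ((n 0 0 - n 0 3) * n 0 3 + n 0 1 * (n 0 5 - n 0 2))
    - (n 0 0 - n 0 3) * (n 0 2 * n 0 3 - n 0 1 * n 0 4)); first by ring.
  by rewrite e00 e01 !mulr0 subr0.
have n3 : n 0 3 = 0.
  apply: (mulIf eps0); rewrite mul0r -e11.
  transitivity (n 0 4 * ((n 0 0 - n 0 3) * n 0 3 + n 0 1 * (n 0 5 - n 0 2))
    + (n 0 5 - n 0 2) * (n 0 2 * n 0 3 - n 0 1 * n 0 4)); first by ring.
  by rewrite e00 e01 !mulr0 addr0.
exists A, (n 0 0), (n 0 2), (n 0 4), (n 0 5); split.
  apply/framed_adapted; suff -> : row6 (n 0 0) 0 (n 0 2) 0 (n 0 4) (n 0 5) = n by [].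
  by apply: row6P; rewrite row6E.
by rewrite -e11 n3 subr0.
Qed.

End Action.

(** * Invariants of the models in O^1_+ *)

Section Orbits.
Variable R : realType.
Implicit Types (m n : 'rV[R]_6) (A M : 'M[R]_2).

Lemma rank1_det M : \rank M = 1%N -> M 0 0 * M 1 1 = M 0 1 * M 1 0.
Proof.
move=> rM; apply/eqP; rewrite -subr_eq0 -det2; apply/eqP.
apply: contra_eq rM => d0.
by rewrite mxrank_unit// unitmxE unitfE.
Qed.

Lemma quadratic_form2 M (v : 'rV[R]_2) : (v *m M *m v^T) 0 0 =
  v 0 0 * v 0 0 * M 0 0 + v 0 0 * v 0 1 * (M 0 1 + M 1 0) + v 0 1 * v 0 1 * M 1 1.
Proof. by rewrite !mxE sum2E !mxE !sum2E; ring. Qed.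

(** The determinant vanishes, so w is the first row divided by the square root of M 0 0; if M 0 0 =
    0 that row is zero and M 1 1 provides w. *)
Lemma rank1_psd M : \rank M = 1%N -> M 0 1 = M 1 0 -> psd M ->
  exists w0 w1, [/\ w0 ^+ 2 + w1 ^+ 2 != 0, M 0 0 = w0 * w0, M 0 1 = w0 * w1
                  & M 1 1 = w1 * w1].
Proof.
move=> rM sM pM; have dM := rank1_det rM; rewrite -sM in dM.
have M00 : 0 <= M 0 0.
  have := pM (ev R 0); rewrite quadratic_form2 !ev_coord /=.
  by rewrite !mulr0 !mul0r !addr0 !mul1r.
have M11 : 0 <= M 1 1.
  have := pM (ev R 1); rewrite quadratic_form2 !ev_coord /=.
  by rewrite !mulr0 !mul0r !add0r !mul1r.
have [M0|M0] := eqVneq (M 0 0) 0.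
  have M01 : M 0 1 = 0 by apply/eqP; rewrite -sqrf_eq0 expr2 -dM M0 mul0r.
  have M10 : M 1 1 != 0.
    apply/eqP => M10; suff M_0 : M = 0 by rewrite M_0 mxrank0 in rM.
    by apply/matrixP; apply: ord2_ind; apply: ord2_ind; rewrite mxE -?sM.
  exists 0, (Num.sqrt (M 1 1)); rewrite sqr_sqrtr// expr0n /= add0r !mul0r.
  by split=> //; rewrite -expr2 sqr_sqrtr.
have s0 : Num.sqrt (M 0 0) != 0 by rewrite sqrtr_eq0 -ltNge lt0r M0.
exists (Num.sqrt (M 0 0)), (M 0 1 / Num.sqrt (M 0 0)).
have s2 : Num.sqrt (M 0 0) * Num.sqrt (M 0 0) = M 0 0 by rewrite -expr2 sqr_sqrtr.
split=> //.
- rewrite sqr_sqrtr//; apply: lt0r_neq0; rewrite ltr_wpDr ?sqr_ge0// lt0r M0//.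
- by rewrite mulrCA mulfV ?mulr1.
- rewrite mulf_div s2 -dM; field; exact: M0.
Qed.

Lemma outer_psd M (w0 w1 : R) : w0 ^+ 2 + w1 ^+ 2 != 0 ->
  M 0 0 = w0 * w0 -> M 0 1 = w0 * w1 -> M 1 0 = w0 * w1 -> M 1 1 = w1 * w1 ->
  \rank M = 1%N /\ psd M.
Proof.
move=> w M00 M01 M10 M11; split; last first.
  move=> v; rewrite quadratic_form2 M00 M01 M10 M11.
  have -> : v 0 0 * v 0 0 * (w0 * w0) + v 0 0 * v 0 1 * (w0 * w1 + w0 * w1)
    + v 0 1 * v 0 1 * (w1 * w1) = (v 0 0 * w0 + v 0 1 * w1) ^+ 2 by ring.
  exact: sqr_ge0.
pose u : 'rV[R]_2 := \row_i (if i == 0 then w0 else w1).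
have ME : M = u^T *m u.
  apply/matrixP; apply: ord2_ind; apply: ord2_ind;
    by rewrite !mxE big_ord1 !mxE /= ?M00 ?M01 ?M10 ?M11 // mulrC.
apply/eqP; rewrite eqn_leq; apply/andP; split.
  by rewrite ME; apply: leq_trans (mxrankM_maxl _ _) _; exact: rank_leq_col.
rewrite lt0n mxrank_eq0; apply: contra_neq w => M0.
by move: M00 M11; rewrite M0 !mxE !expr2 => <- <-; rewrite addr0.
Qed.

(** The model whose standard basis is the normalised frame Z, Y; its Ricci matrix does not depend on
    t. *)
Definition normal_form (t : R) : 'rV[R]_6 := row6 1 0 0 0 1 t.

Lemma ricciA_sym m : ricciA m 0 1 = ricciA m 1 0.
Proof. by rewrite !ricciAE. Qed.

Lemma A1minus_admitsB m : A1minus m -> admitsB m.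
Proof.
move=> [rm nm].
have pN : psd (- ricciA m).
  by move=> v; have := nm v; rewrite mulmxN mulNmx !mxE oppr_ge0.
have rN : \rank (- ricciA m) = 1%N by rewrite mxrank_opp.
have sN : (- ricciA m) 0 1 = (- ricciA m) 1 0 by rewrite [LHS]mxE [RHS]mxE ricciA_sym.
have [w0 [w1 [w2 r00 r01 r11]]] := rank1_psd rN sN pN.
have E i j (u v : R) : (- ricciA m) i j = u * v -> ricciA m i j = -1 * u * v.
  by rewrite [LHS]mxE -mulrA mulN1r => <-; rewrite opprK.
have N1 : (-1 : R) != 0 by rewrite oppr_eq0 oner_neq0.
have [A [a [c [e [f [ad ee]]]]]] :=
  adapted_exists N1 w2 (E _ _ _ _ r00) (E _ _ _ _ r01) (E _ _ _ _ r11).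
apply: (admitsB_bound ad); rewrite ee mulrN1.
by apply: le_trans (sqr_ge0 _); rewrite oppr_le0.
Qed.

(** Dividing Z by a and shearing Y by a multiple of Z gives a = 1 and c = 0; invariance of c (f - c)
    + a e = 1 then forces e = 1. The sign v of Y is chosen to make the determinant positive, and t =
    v f. *)
Lemma O1plusP m : O1plus m <->
  exists A t, [/\ 0 < \det A, adapted m A 1 0 1 t & t ^+ 2 < 4].
Proof.
split=> [[[rm pm] nB]|[A [t [D0 ad t4]]]]; last first.
  split; last first.
    move=> mB; have := adapted_admitsB_bound ad _ mB.
    by rewrite mul0r mulr1 add0r => /(_ erefl); rewrite leNgt t4.
  have r i j := adapted_ricci i j ad; rewrite mul0r mulr1 add0r in r.
  apply: (@outer_psd _ (coframe A 0) (coframe A 1)); rewrite ?r ?mul1r//; last by rewrite mulrC.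
  have [DA _] := ad; have [_ c1] := coframe_dual DA.
  rewrite paddr_eq0 ?sqr_ge0// !sqrf_eq0; apply/negP => /andP[/eqP z0 /eqP z1].
  by move/eqP: c1; rewrite z0 z1 !mul0r addr0 eq_sym oner_eq0.
have [w0 [w1 [w2 r00 r01 r11]]] := rank1_psd rm (ricciA_sym m) pm.
have E (x u v : R) : x = u * v -> x = 1 * u * v by rewrite mul1r.
have [A [a [c [e [f [ad ee]]]]]] :=
  adapted_exists (oner_neq0 R) w2 (E _ _ _ r00) (E _ _ _ r01) (E _ _ _ r11).
have f4 : f ^+ 2 < 4.
  rewrite ltNge; apply/negP => f4; apply: nB; apply: (admitsB_bound ad).
  by rewrite ee mulr1.
(* If a = 0 then f^2 - 4 = (f - 2 c)^2, against f^2 < 4. *)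
have a0 : a != 0.
  apply/eqP => a0; have := sqr_ge0 (f - 2 * c).
  have -> : (f - 2 * c) ^+ 2 = f ^+ 2 - 4 * (c * (f - c) + a * e) by rewrite a0; ring.
  by rewrite ee mulr1 subr_ge0 leNgt f4.
have [DA _] := ad.
have change v : v * v = 1 -> adapted m
   (\matrix_(k, l) (if l == 0 then a^-1 * A k 0 else v * A k 1 + - (v * c / a) * A k 0))
   1 0 1 (v * f).
  move=> vv.
  have := adapted_change (- (v * c / a)) (invr_neq0 a0) vv ad.
  have -> : a^-1 * a = 1 by rewrite mulVf.
  have -> : v * c + - (v * c / a) * a = 0 by field.
  have -> // : (e + 2 * v * - (v * c / a) * c + (- (v * c / a)) ^+ 2 * a
     - f * v * - (v * c / a)) / a^-1 = 1.
  rewrite -[RHS]ee.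
  transitivity (a * e - (v * v) * 2 * c ^+ 2 + (v * v) * c ^+ 2 + (v * v) * f * c); first by field.
  by rewrite vv; ring.
have det v : \det (\matrix_(k, l) (if l == 0 then a^-1 * A k 0
    else v * A k 1 + - (v * c / a) * A k 0)) =
    v * (a^-1 * (A 0 0 * A 1 1 - A 0 1 * A 1 0)).
  by rewrite det2 !mxE /=; ring.
have [p|p|p] := ltrgt0P (a^-1 * (A 0 0 * A 1 1 - A 0 1 * A 1 0)).
- exists (\matrix_(k, l) (if l == 0 then a^-1 * A k 0
    else 1 * A k 1 + - (1 * c / a) * A k 0)), (1 * f).
  by split; [rewrite det mul1r|apply: change; rewrite mulr1|rewrite mul1r].
- exists (\matrix_(k, l) (if l == 0 then a^-1 * A k 0
    else -1 * A k 1 + - (-1 * c / a) * A k 0)), (-1 * f).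
  split; [by rewrite det mulN1r oppr_gt0|by apply: change; rewrite mulrNN mulr1|].
  by rewrite mulN1r sqrrN.
- by move/eqP: p; rewrite mulf_eq0 invr_eq0 (negbTE a0) (negbTE DA).
Qed.

Lemma O1plus_actA (B : 'M[R]_2) m : 0 < \det B -> O1plus m -> O1plus (actA B m).
Proof.
move=> B0 /O1plusP[A [t [A0 ad t4]]]; apply/O1plusP; exists (B *m A), t; split => //.
  by rewrite det_mulmx mulr_gt0.
by apply/framed_adapted/framed_actA; [rewrite -det2 lt0r_neq0|exact/framed_adapted].
Qed.

(* For m with basis Z, Y as in [adapted m A 1 0 1 t] and D = det A > 0, the
   vector K = - Z / D is (- w_1, w_0), and [kernel_acc m] is nabla_K K = Z / D^2,
   a polynomial in m since r_ij = w_i w_j. Its norm and that of w recover D, then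
   Z and w, and Y is the vector w / |w|^2 corrected by its derivative along Z. *)
Definition trace_ricci m : R := ricciA m 0 0 + ricciA m 1 1.
Definition kernel_acc m k : R := Gam m 0 0 k * ricciA m 1 1 - 2 * Gam m 0 1 k * ricciA m 0 1
  + Gam m 1 1 k * ricciA m 0 0.
Definition kernel_acc_sq m : R := kernel_acc m 0 * kernel_acc m 0 + kernel_acc m 1 * kernel_acc m 1.
Definition inv_det m : R := Num.sqrt (kernel_acc_sq m / trace_ricci m).
Definition frameZ m k : R := kernel_acc m k * (trace_ricci m / kernel_acc_sq m).
Definition oriented_coframe m (i : 'I_2) : R :=
  (if i == 0 then - kernel_acc m 1 else kernel_acc m 0) / inv_det m.
Definition modulus m : R := ((Gam m 0 0 0 + Gam m 1 1 0) * oriented_coframe m 0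
  + (Gam m 0 0 1 + Gam m 1 1 1) * oriented_coframe m 1) / trace_ricci m.
Definition frameY m k : R := oriented_coframe m k / trace_ricci m
  - conn m k (frameZ m 0) (frameZ m 1)
  (oriented_coframe m 0 / trace_ricci m) (oriented_coframe m 1 / trace_ricci m).

(** Frame and parameter are formulas in m alone: this gives freeness of the action, injectivity of
    the trivialisation and continuity of its inverse. *)
Lemma adapted_invariants m A t : 0 < \det A -> adapted m A 1 0 1 t ->
  [/\ trace_ricci m != 0, kernel_acc_sq m != 0, inv_det m != 0, modulus m = t
    & forall k, frameZ m k = A k 0 /\ frameY m k = A k 1].
Proof.
rewrite det2 => D0 ad; have [DA cA] := ad.
set D := A 0 0 * A 1 1 - A 0 1 * A 1 0 in D0 DA.
have r i j := adapted_ricci i j ad; rewrite mul0r mulr1 add0r in r.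
have w0 : coframe A 0 = - A 1 0 / D by [].
have w1 : coframe A 1 = A 0 0 / D by [].
have Z2 : 0 < A 0 0 * A 0 0 + A 1 0 * A 1 0.
  rewrite lt0r addr_ge0 -?expr2 ?sqr_ge0// andbT paddr_eq0 ?sqr_ge0// !sqrf_eq0.
  by apply: contraNN DA => /andP[/eqP z0 /eqP z1]; rewrite /D z0 z1 mul0r mulr0 subrr.
have tauE : trace_ricci m = (A 0 0 * A 0 0 + A 1 0 * A 1 0) / D ^+ 2.
  by rewrite /trace_ricci !r w0 w1 !mul1r; field.
have NE k : kernel_acc m k = A k 0 / D ^+ 2.
  have [h _ _] := cA k.
  rewrite -[A k 0]mul1r -h /kernel_acc !r w0 w1 /conn /bquad; field; exact: DA.
have NsqE : kernel_acc_sq m = (A 0 0 * A 0 0 + A 1 0 * A 1 0) / D ^+ 4.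
  by rewrite /kernel_acc_sq !NE; field.
have Z20 := lt0r_neq0 Z2.
have tau0 : trace_ricci m != 0 by rewrite tauE mulf_neq0// invr_neq0// expf_neq0.
have Nsq0 : kernel_acc_sq m != 0 by rewrite NsqE mulf_neq0// invr_neq0// expf_neq0.
(* The square root is 1 / D and not its opposite because D > 0; here the orientation enters. *)
have ideE : inv_det m = D^-1.
  rewrite /inv_det NsqE tauE.
  have -> : (A 0 0 * A 0 0 + A 1 0 * A 1 0) / D ^+ 4 /
    ((A 0 0 * A 0 0 + A 1 0 * A 1 0) / D ^+ 2) = D^-1 ^+ 2 by field; rewrite DA Z20.
  by rewrite sqrtr_sqr ger0_norm// invr_ge0 ltW.
have ide0 : inv_det m != 0 by rewrite ideE invr_neq0.
have wE i : oriented_coframe m i = coframe A i.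
  by elim/ord2_ind: i; rewrite /oriented_coframe ideE !NE /= ?w0 ?w1; field.
have ZE k : frameZ m k = A k 0.
  by rewrite /frameZ NE tauE NsqE; field; rewrite DA Z20.
split=> //.
  (* By w o Gamma = t w (x) w the numerator is t |w|^2, and the Ricci trace is |w|^2. *)
  rewrite /modulus !wE.
  have c00 := adapted_coframe 0 0 ad; have c11 := adapted_coframe 1 1 ad.
  transitivity (((Gam m 0 0 0 * coframe A 0 + Gam m 0 0 1 * coframe A 1)
    + (Gam m 1 1 0 * coframe A 0 + Gam m 1 1 1 * coframe A 1)) / trace_ricci m).
    by congr (_ / _); ring.
  rewrite c00 c11; apply: (mulIf tau0); rewrite mulfVK//.
  by rewrite /trace_ricci !r; ring.
move=> k; split => //; rewrite /frameY !wE !ZE.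
(* Here w / |w|^2 = Y - v Z, whose derivative along Z is - v Z; subtracting it leaves Y. *)
pose v := (A 0 0 * A 0 1 + A 1 0 * A 1 1) / (A 0 0 * A 0 0 + A 1 0 * A 1 0).
have Y0 l : coframe A l / trace_ricci m = A l 1 - v * A l 0.
  by rewrite tauE /v; elim/ord2_ind: l; rewrite ?w0 ?w1 /D; field; rewrite -/D DA Z20.
rewrite !Y0; have [h1 h2 _] := cA k.
have -> : conn m k (A 0 0) (A 1 0) (A 0 1 - v * A 0 0) (A 1 1 - v * A 1 0) =
   conn m k (A 0 0) (A 1 0) (A 0 1) (A 1 1) - v * conn m k (A 0 0) (A 1 0) (A 0 0) (A 1 0).
  by rewrite /conn /bquad; ring.
by rewrite h1 h2; ring.
Qed.

End Orbits.

(** * The bundle *)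

Section Topology.
Variable R : realType.

Lemma continuous_mx (T : topologicalType) (p q : nat) (M : T -> 'M[R]_(p, q)) (x : T) :
  (forall i j, {for x, continuous (fun y => M y i j)}) -> {for x, continuous M}.
Proof.
move=> cM; apply/cvgrPdist_le => /= e e0; near=> y.
rewrite /Num.Def.normr/= mx_normrE (bigmax_le _ (ltW e0))//= => i _.
rewrite !mxE/=.
move: i; near: y; apply: filter_forall => /= i.
exact: ((cvgrPdist_le _ _).1 (cM i.1 i.2)).
Unshelve. all: by end_near. Qed.

(** A homeomorphism of R onto ]-2, 2[ with inverse [fiber_inv], making R the base of the bundle. *)
Definition fiber_coord (t : R) : R := 2 * t / (1 + `|t|).
Definition fiber_inv (u : R) : R := u / (2 - `|u|).

Lemma fiber_coord_lt t : (fiber_coord t) ^+ 2 < 4.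
Proof.
have t1 : 0 < 1 + `|t| by rewrite ltr_wpDr.
rewrite -real_normK ?num_real// /fiber_coord normrM normfV normrM.
rewrite (ger0_norm (ler0n _ 2)) (gtr0_norm t1).
have -> : (4 : R) = 2 ^+ 2 by rewrite -natrX.
rewrite ltrXn2r//= ?divr_ge0 ?mulr_ge0 ?ltW// ltr_pdivrMr// ltr_pM2l//.
by rewrite ltrDr.
Qed.

Lemma sqr_lt4_norm (u : R) : u ^+ 2 < 4 -> `|u| < 2.
Proof.
move=> u4; rewrite -(ltr_pXn2r (n := 2)) ?nnegrE//.
by rewrite real_normK ?num_real// -natrX.
Qed.

Lemma fiber_coordK t : fiber_inv (fiber_coord t) = t.
Proof.
have t1 : 0 < 1 + `|t| by rewrite ltr_wpDr.
rewrite /fiber_inv /fiber_coord normrM normfV normrM.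
rewrite (ger0_norm (ler0n _ 2)) (gtr0_norm t1).
field; rewrite (lt0r_neq0 t1) /=.
have -> : 2 * (1 + `|t|) - 2 * `|t| = 2 by ring.
by rewrite pnatr_eq0.
Qed.

Lemma fiber_invK u : u ^+ 2 < 4 -> fiber_coord (fiber_inv u) = u.
Proof.
move=> /sqr_lt4_norm u2; have d0 : 0 < 2 - `|u| by rewrite subr_gt0.
rewrite /fiber_coord /fiber_inv normrM normfV (gtr0_norm d0).
field; rewrite (lt0r_neq0 d0) /=.
have -> : 2 - `|u| + `|u| = 2 by ring.
by rewrite pnatr_eq0.
Qed.

Section Pointwise.
Variables (T : topologicalType) (x : T).
Implicit Types f g : T -> R.

Definition cont_at f := {for x, continuous f}.

Lemma cont_cst (c : R) : cont_at (fun=> c).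
Proof. exact: cst_continuous. Qed.

Lemma cont_add f g : cont_at f -> cont_at g -> cont_at (fun y => f y + g y).
Proof. by move=> cf cg; exact: (continuousD cf cg). Qed.

Lemma cont_opp f : cont_at f -> cont_at (fun y => - f y).
Proof. by move=> cf; exact: (continuousN cf). Qed.

Lemma cont_mul f g : cont_at f -> cont_at g -> cont_at (fun y => f y * g y).
Proof. by move=> cf cg; exact: (continuousM cf cg). Qed.

Lemma cont_inv f : f x != 0 -> cont_at f -> cont_at (fun y => (f y)^-1).
Proof. by move=> f0 cf; exact: (continuousV f0 cf). Qed.

Lemma cont_sqrt f : cont_at f -> cont_at (fun y => Num.sqrt (f y)).
Proof. by move=> cf; apply: (continuous_comp cf); exact: sqrt_continuous. Qed.

Lemma cont_norm f : cont_at f -> cont_at (fun y => `|f y|).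
Proof. by move=> cf; apply: (continuous_comp cf); exact: norm_continuous. Qed.

End Pointwise.

Ltac cont := lazymatch goal with
  | |- cont_at ?x (fun _ => ?c) => exact (@cont_cst _ x c)
  | |- cont_at ?x (fun y => @?f y + @?g y) => apply (@cont_add _ x f g); cont
  | |- cont_at ?x (fun y => - @?f y) => apply (@cont_opp _ x f); cont
  | |- cont_at ?x (fun y => @?f y * @?g y) => apply (@cont_mul _ x f g); cont
  | |- _ => match goal with h : _ |- _ => solve [simple apply h] end
  end.

Lemma coord_cont_at i (x : 'rV[R]_6) : cont_at x (fun m : 'rV[R]_6 => m 0 i).
Proof. exact: coord_continuous. Qed.

Lemma ricciA_cont_at (x : 'rV[R]_6) i j : cont_at x (fun m : 'rV[R]_6 => ricciA m i j).
Proof.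
have h k := @coord_cont_at k x.
have -> : (fun m : 'rV[R]_6 => ricciA m i j) = (fun m : 'rV[R]_6 =>
    if (i == 0) && (j == 0) then (m 0 0 - m 0 3) * m 0 3 + m 0 1 * (m 0 5 - m 0 2)
    else if (i == 1) && (j == 1) then m 0 2 * (m 0 5 - m 0 2) + (m 0 0 - m 0 3) * m 0 4
    else m 0 2 * m 0 3 - m 0 1 * m 0 4) by apply/funext => m; rewrite mxE.
by case: (_ && _); [|case: (_ && _)]; cont.
Qed.

Definition Phi (p : 'M[R]_2 * R) : 'rV[R]_6 := actA p.1 (normal_form (fiber_coord p.2)).

Definition Psi (m : 'rV[R]_6) : 'M[R]_2 * R :=
  (\matrix_(k, l) (if l == 0 then frameZ m k else frameY m k), fiber_inv (modulus m)).

Lemma Phi_adapted p : 0 < \det p.1 -> adapted (Phi p) p.1 1 0 1 (fiber_coord p.2).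
Proof.
move=> D0; apply/framed_adapted/framedP => //.
by rewrite -det2 lt0r_neq0.
Qed.

Lemma PhiK p : 0 < \det p.1 -> Psi (Phi p) = p.
Proof.
move=> D0; have [_ _ _ mt fr] := adapted_invariants D0 (Phi_adapted D0).
rewrite /Psi mt fiber_coordK [RHS]surjective_pairing; congr (_, _).
apply/matrixP => k; have [zk yk] := fr k.
by apply: ord2_ind; rewrite mxE /= ?zk ?yk.
Qed.

Lemma adapted_Phi m A t : 0 < \det A -> adapted m A 1 0 1 t -> t ^+ 2 < 4 ->
  Phi (A, fiber_inv t) = m.
Proof.
move=> D0 ad t4; apply/esym; rewrite /Phi /= fiber_invK//.
by apply/framedP; [rewrite -det2 lt0r_neq0|exact/framed_adapted].
Qed.

(** At a model of O^1_+ every denominator is nonzero, by [adapted_invariants] and, for 2 - |t|, by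
    t^2 < 4. *)
Lemma Psi_continuous m : O1plus m -> {for m, continuous Psi}.
Proof.
move=> /O1plusP[A [t [D0 ad t4]]].
have [tau0 N0 d0 mt _] := adapted_invariants D0 ad.
have ric := @ricciA_cont_at m.
have gam i j k : cont_at m (fun y => Gam y i j k) by exact: coord_cont_at.
have cN k : cont_at m (fun y => kernel_acc y k) by rewrite /kernel_acc; cont.
have ctau : cont_at m (@trace_ricci R) by rewrite /trace_ricci; cont.
have cNsq : cont_at m (@kernel_acc_sq R) by rewrite /kernel_acc_sq; cont.
have citau : cont_at m (fun y => (trace_ricci y)^-1) by exact: cont_inv.
have ciN : cont_at m (fun y => (kernel_acc_sq y)^-1) by exact: cont_inv.
have cd : cont_at m (@inv_det R) by apply: cont_sqrt; cont.
have cid : cont_at m (fun y => (inv_det y)^-1) by exact: cont_inv.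
have cZ k : cont_at m (fun y => frameZ y k) by rewrite /frameZ; cont.
have cw i : cont_at m (fun y => oriented_coframe y i).
  by rewrite /oriented_coframe; case: (i == 0); cont.
have cY k : cont_at m (fun y => frameY y k) by rewrite /frameY /conn /bquad; cont.
have cm : cont_at m (@modulus R) by rewrite /modulus; cont.
have cmi : cont_at m (fun y => (2 - `|modulus y|)^-1).
  apply: cont_inv.
    by rewrite mt subr_eq0 gt_eqF// sqr_lt4_norm.
  by have := cont_norm cm => cn; cont.
have ct : cont_at m (fun y => fiber_inv (modulus y)) by rewrite /fiber_inv; cont.
have cF : {for m, continuous (fun m => \matrix_(k, l) (if l == 0 then frameZ m k else frameY m k)
    : 'M[R]_2)}; last exact: (cvg_pair cF ct).
apply: (@continuous_mx _ _ _ (fun m => \matrix_(k, l) (if l == 0 then frameZ m k else frameY m k))).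
move=> k l.
have -> : (fun y : 'rV[R]_6 => (\matrix_(k, l) (if l == 0 then frameZ y k else frameY y k)
    : 'M[R]_2) k l) = (fun y => if l == 0 then frameZ y k else frameY y k).
  by apply/funext => y; rewrite mxE.
by case: (l == 0); [exact: cZ|exact: cY].
Qed.

Lemma Phi_continuous : {within [set p : 'M[R]_2 * R | GLplus p.1], continuous Phi}.
Proof.
pose D (p : 'M[R]_2 * R) := p.1 0 0 * p.1 1 1 - p.1 0 1 * p.1 1 0.
pose t (p : 'M[R]_2 * R) := fiber_coord p.2.
(* These are the symbols of [adapted_conn] for a = e = 1, c = 0, f = t: rational functions of the
   frame and t, equal to [Phi] where the determinant is positive. *)
pose g00 k (p : 'M[R]_2 * R) := (p.1 1 1 * p.1 1 1 * p.1 k 0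
  + p.1 1 0 * p.1 1 0 * (p.1 k 0 + t p * p.1 k 1)) * ((D p)^-1 * (D p)^-1).
pose g01 k (p : 'M[R]_2 * R) := (- p.1 0 1 * p.1 1 1 * p.1 k 0
  - p.1 0 0 * p.1 1 0 * (p.1 k 0 + t p * p.1 k 1)) * ((D p)^-1 * (D p)^-1).
pose g11 k (p : 'M[R]_2 * R) := (p.1 0 1 * p.1 0 1 * p.1 k 0
  + p.1 0 0 * p.1 0 0 * (p.1 k 0 + t p * p.1 k 1)) * ((D p)^-1 * (D p)^-1).
pose PhiX p := row6 (g00 0 p) (g00 1 p) (g01 0 p) (g01 1 p) (g11 0 p) (g11 1 p).
have PhiE p : 0 < \det p.1 -> PhiX p = Phi p.
  move=> D0; have [h0 h1] := (adapted_conn (Phi_adapted D0) 0, adapted_conn (Phi_adapted D0) 1).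
  move: h0 h1; rewrite !GamE => -[e0 e2 e4] [e1 e3 e5].
  have DD : (D p)^-1 * (D p)^-1 = ((p.1 0 0 * p.1 1 1 - p.1 0 1 * p.1 1 0) ^+ 2)^-1.
    by rewrite -invfM -expr2.
  by apply: row6P; rewrite row6E ?e0 ?e1 ?e2 ?e3 ?e4 ?e5 /g00 /g01 /g11 DD /t;
    congr (_ * _); ring.
apply: (@subspace_eq_continuous _ _ _ PhiX).
  by move=> p; rewrite inE => /PhiE.
apply: continuous_in_subspaceT => p; rewrite inE /GLplus /= det2 => D0.
have c1 i j : cont_at p (fun y : 'M[R]_2 * R => y.1 i j).
  apply: (@continuous_comp _ _ _ fst (fun M : 'M[R]_2 => M i j)); first exact: cvg_fst.
  exact: coord_continuous.
have c2 : cont_at p (fun y : 'M[R]_2 * R => y.2) by exact: cvg_snd.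
have cD : cont_at p D by rewrite /D; cont.
have cDi : cont_at p (fun y => (D y)^-1).
  by apply: cont_inv => //; exact: lt0r_neq0.
have cti : cont_at p (fun y : 'M[R]_2 * R => (1 + `|y.2|)^-1).
  apply: cont_inv; first by apply: lt0r_neq0; rewrite ltr_wpDr.
  by have := cont_norm c2 => cn; cont.
have ct : cont_at p t by rewrite /t /fiber_coord; cont.
have cg00 k : cont_at p (g00 k) by rewrite /g00; cont.
have cg01 k : cont_at p (g01 k) by clear cg00; rewrite /g01; cont.
have cg11 k : cont_at p (g11 k) by clear cg00 cg01; rewrite /g11; cont.
apply: continuous_mx => i l; rewrite (ord1 i).
have rowE (y : 'M[R]_2 * R) : PhiX y 0 l = nth 0 [:: g00 0 y; g00 1 y; g01 0 y; g01 1 y;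
  g11 0 y; g11 1 y] l by rewrite mxE.
rewrite (funext rowE); case: l {rowE} => [[|[|[|[|[|[|//]]]]]] l6] /=.
- exact: (cg00 0).
- exact: (cg00 1).
- exact: (cg01 0).
- exact: (cg01 1).
- exact: (cg11 0).
- exact: (cg11 1).
Qed.

End Topology.

Theorem theorem1p3 (R : realType) :
  (* (1) *)
  (@O1minus R = set0 /\ (forall m : 'rV[R]_6, A1minus m -> admitsB m))
  /\
  (* (2) GL_+(2,R) acts on O^1_+, without fixed points, with a section s
     such that (T, t) |-> T . s(t) is a homeomorphism GL_+(2,R) x R ~ O^1_+ *)
  [/\ (forall (A : 'M[R]_2) m, @GLplus R A -> @O1plus R m -> @O1plus R (actA A m)),
      (forall (A : 'M[R]_2) m, @GLplus R A -> @O1plus R m -> actA A m = m -> A = 1%:M)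
    & exists s : R -> 'rV[R]_6,
        let Phi := fun p : 'M[R]_2 * R => actA p.1 (s p.2) in
        let D := [set p : 'M[R]_2 * R | @GLplus R p.1] in
        [/\ (forall t, @O1plus R (s t)),
            set_bij D (@O1plus R) Phi,
            {within D, continuous Phi}
          & exists Psi : 'rV[R]_6 -> 'M[R]_2 * R,
              (forall p, D p -> Psi (Phi p) = p) /\ {within @O1plus R, continuous Psi}]].
Proof.
split.
  split; last exact: A1minus_admitsB.
  by apply/seteqP; split=> // m [/A1minus_admitsB].
split.
- by move=> A m A0 mO; exact: O1plus_actA.
- move=> A m A0 mO Am.
  (* If A fixes m, both [A0'] and [A *m A0'] are positively oriented normalised frames of m, so they
     coincide. *)
  have /O1plusP[A0' [t [D0 ad t4]]] := mO.
  have mE := adapted_Phi D0 ad t4.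
  have adA : adapted m (A *m A0') 1 0 1 t.
    rewrite -{1}Am; apply/framed_adapted/framed_actA; last exact/framed_adapted.
    by rewrite -det2 lt0r_neq0.
  have DA : 0 < \det (A *m A0') by rewrite det_mulmx mulr_gt0.
  have [_ _ _ _ fr] := adapted_invariants D0 ad.
  have [_ _ _ _ frA] := adapted_invariants DA adA.
  have AA : A *m A0' = A0'.
    apply/matrixP => k; have [z y] := fr k; have [zA yA] := frA k.
    by apply: ord2_ind; [rewrite -zA|rewrite -yA].
  have uA : A0' \in unitmx by rewrite unitmxE unitfE lt0r_neq0.
  by rewrite -[A](mulmxK uA) AA mulmxV.
exists (fun t => normal_form (fiber_coord t)) => Phi0 D; split.
- move=> t; apply/O1plusP; exists 1%:M, (fiber_coord t); split.
  + by rewrite det1 ltr01.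
  + by apply/framed_adapted; exact: framed_std.
  + exact: fiber_coord_lt.
- split.
  + move=> p Dp; apply/O1plusP; exists p.1, (fiber_coord p.2); split => //.
      exact: Phi_adapted.
    exact: fiber_coord_lt.
  + move=> p p'; rewrite !inE => Dp Dp' e.
    by rewrite -(PhiK Dp) -(PhiK Dp'); congr Psi.
  + move=> m /O1plusP[A [t [D0 ad t4]]]; exists (A, fiber_inv t) => //.
    exact: adapted_Phi.
- exact: Phi_continuous.
exists (@Psi R); split; first by move=> p Dp; exact: PhiK.
by apply: continuous_in_subspaceT => m; rewrite inE => /Psi_continuous.
Qed.
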